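(* For all $n\geq 4$ we have $$\widehat{\operatorname{Gr}}^+_{\mathrm{iso}}(V_n)=V\big(\operatorname{rad}(\operatorname{Spin}(V_n)\cdot I_4)\big),$$ where $I_4$ is the ideal of polynomials defining $\widehat{\operatorname{Gr}}^+_{\mathrm{iso}}(V_4)\subseteq\operatorname{Cl}^+(V_4)f$, and $\operatorname{rad}(\operatorname{Spin}(V_n)\cdot I_4)$ is the radical ideal generated by the $\operatorname{Spin}(V_n)$-orbits of (the pullbacks of) the elements of $I_4$.
   Context: $K$ is an algebraically closed field of characteristic $0$. $V_n=\langle e_1,\dots,e_n,f_1,\dots,f_n\rangle$ is the $2n$-dimensional quadratic space with bilinear form $(e_i|e_j)=(f_i|f_j)=0$, $(e_i|f_j)=\delta_{ij}$, and $q(v)=(v|v)$; $E_n=\langle e_1,\ldots,e_n\rangle$, $F_n=\langle f_1,\dots,f_n\rangle$. $\operatorname{Cl}(V_n)=T(V_n)/(v\otimes v-q(v)\cdot1)=\operatorname{Cl}^+\oplus\operatorname{Cl}^-$ is the Clifford algebra and $f:=f_1\cdots f_n\in \operatorname{Cl}(V_n)$; the spin representation is the left ideal $\operatorname{Cl}(V_n)f$, with half-spin representations $\operatorname{Cl}^\pm(V_n)f$. The Lie algebra $\mathfrak{so}(V_n)$ is embedded in $\operatorname{Cl}^+(V_n)$ by identifying $u\wedge v\in\bigwedge^2V_n\cong\mathfrak{so}(V_n)$ (the map $w\mapsto(v|w)u-(u|w)v$) with $\frac14(uv-vu)$, acting by left multiplication. $\operatorname{Spin}(V_n)\subseteq\operatorname{GL}(\operatorname{Cl}(V_n)f)$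 is the subgroup generated by all $\exp(tX)$, $t\in K$, with $X$ among $e_i\wedge e_j,f_i\wedge f_j,e_i\wedge f_j$ ($i\neq j$). For a maximal ($n$-dimensional) isotropic subspace $H\subseteq V_n$, the space $S_H=\{\omega\in\operatorname{Cl}(V_n)f: v\cdot\omega=0\ \forall v\in H\}$ is one-dimensional. The isotropic Grassmann cone is $\widehat{\operatorname{Gr}}_{\mathrm{iso}}(V_n)=\bigcup_HS_H\subseteq\operatorname{Cl}(V_n)f$, and $\widehat{\operatorname{Gr}}^{+}_{\mathrm{iso}}(V_n)=\widehat{\operatorname{Gr}}_{\mathrm{iso}}(V_n)\cap\operatorname{Cl}^+(V_n)f$. The coordinate ring of $\operatorname{Cl}^+(V_4)f_1\cdots f_4$ is regarded as a subring of that of $\operatorname{Cl}^+(V_n)f_1\cdots f_n$ via pullback along the linear map $\pi_{n,4}$ which, under the identifications $\bigwedge^+E_n\cong\operatorname{Cl}^+(V_n)f_1\cdots f_n$, $\omega\mapsto\omega f_1\cdots f_n$ (even-degree part of the exterior algebra), is the map $\bigwedge^+E_n\to\bigwedge^+E_4$ induced by the projection $E_n\to E_4$ with $e_i\mapsto0$ for $i>4$. $V(J)$ is the closed subset defined by $J$. *)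

(* Defs.v *)
From HB Require Import structures.
From mathcomp Require Import all_boot all_order all_algebra.
From mathcomp Require Import finmap mpoly monalg.
From mathcomp Require Import boolp.

Set Implicit Arguments.
Unset Strict Implicit.
Unset Printing Implicit Defensive.

Import GRing.Theory.
Local Open Scope ring_scope.
Local Open Scope quotient_scope.

(* The bilinear form on row vectors with Gram matrix B; the associated        *)
(* quadratic form is v |-> (v | v), without a factor 1/2.                     *)
Definition bil (F : fieldType) m (B : 'M[F]_m) (u v : 'rV[F]_m) : F :=
  (u *m B *m v^T) 0 0.

(* The tensor algebra T(F^m) is the free algebra on the standard basis of     *)
(* F^m: monomials are words in 'I_m, multiplied by concatenation. The name is *)
(* needed because {malg _[_]} only inherits an algType structure when the     *)
(* monomials commute.                                                         *)
Section TensorAlgebra.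
Variables (F : fieldType) (m : nat).

Definition tensor := {malg F[{fmonom 'I_m}]}.

HB.instance Definition _ := GRing.Lalgebra.on tensor.

Lemma malgC_comm (c : F) (s : tensor) : c%:MP * s = s * c%:MP.
Proof.
rewrite !malgM_def fgmulUg fgmulgU; apply: eq_bigr => k _.
by rewrite mul1m mulm1 mulrC.
Qed.

Lemma tensor_scaleAr (c : F) (s t : tensor) : c *: (s * t) = s * (c *: t).
Proof. by rewrite -[c *: t]mul_malgC mulrA -malgC_comm -mulrA mul_malgC. Qed.

HB.instance Definition _ :=
  GRing.Lalgebra_isAlgebra.Build F tensor tensor_scaleAr.

End TensorAlgebra.

(* Several definitions below are locked only to keep unification from         *)
(* unfolding them.                                                            *)
HB.lock Definition tvec (F : fieldType) (m : nat) (v : 'rV[F]_m) : tensor F m :=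
  \sum_(i < m) << v 0 i *g fmu i >>.

Section TensorVectors.
Variables (F : fieldType) (m : nat).

Lemma tvec_is_linear : linear (@tvec F m).
Proof.
move=> a u v; rewrite tvec.unlock scaler_sumr -big_split; apply: eq_bigr => i _ /=.
rewrite !mxE monalgUD; congr (_ + _).
by rewrite -mul_malgC malgM_def fgmulUU mul1m.
Qed.

HB.instance Definition _ :=
  GRing.isLinear.Build F 'rV[F]_m (tensor F m) *:%R (@tvec F m)
    tvec_is_linear.

End TensorVectors.

(* The quotient of an F-algebra A by the two-sided ideal generated by P.      *)
Section AlgQuotient.
Variables (F : comNzRingType) (A : algType F) (P : A -> Prop).
Implicit Types r s t : A.

Definition gen_ideal : {pred A} := fun t =>
  `[< exists l : seq (A * A * A),
        (forall x, x \in l -> P x.1.2) /\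
        t = \sum_(x <- l) x.1.1 * x.1.2 * x.2 >].

Lemma gen_idealMl s t : t \in gen_ideal -> s * t \in gen_ideal.
Proof.
move=> /asboolP[l [Pl ->]]; apply/asboolP.
exists [seq ((s * x.1.1, x.1.2), x.2) | x <- l]; split.
  by move=> _ /mapP[x xl ->]; exact: Pl xl.
by rewrite big_map mulr_sumr; apply: eq_bigr => x _; rewrite !mulrA.
Qed.

Lemma gen_idealMr s t : t \in gen_ideal -> t * s \in gen_ideal.
Proof.
move=> /asboolP[l [Pl ->]]; apply/asboolP.
exists [seq (x.1, x.2 * s) | x <- l]; split.
  by move=> _ /mapP[x xl ->]; exact: Pl xl.
by rewrite big_map mulr_suml; apply: eq_bigr => x _; rewrite !mulrA.
Qed.

Lemma mem_gen_ideal t : P t -> t \in gen_ideal.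
Proof.
move=> Pt; apply/asboolP; exists [:: ((1, t), 1)]; split.
  by move=> x; rewrite inE => /eqP->.
by rewrite big_seq1 mul1r mulr1.
Qed.

Lemma gen_ideal_zmod : zmod_closed gen_ideal.
Proof.
have D s t : s \in gen_ideal -> t \in gen_ideal -> s + t \in gen_ideal.
  move=> /asboolP[l1 [P1 ->]] /asboolP[l2 [P2 ->]]; apply/asboolP.
  exists (l1 ++ l2); split; last by rewrite big_cat.
  by move=> x; rewrite mem_cat => /orP[/P1|/P2].
split; first by apply/asboolP; exists [::]; rewrite big_nil.
move=> s t sI tI; apply: D => //.
by rewrite -mulN1r gen_idealMl.
Qed.

HB.instance Definition _ :=
  GRing.isZmodClosed.Build A gen_ideal gen_ideal_zmod.

Definition algquot := Quotient.quot gen_ideal.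

HB.instance Definition _ := GRing.Zmodule.on algquot.
HB.instance Definition _ := EqQuotient.on algquot.

End AlgQuotient.

HB.lock Definition qpi (F : comNzRingType) (A : algType F) (P : A -> Prop)
  (t : A) : algquot P := \pi_(algquot P) t.

HB.lock Definition qmul (F : comNzRingType) (A : algType F) (P : A -> Prop)
  (x y : algquot P) : algquot P := qpi P (repr x * repr y).

HB.lock Definition qscale (F : comNzRingType) (A : algType F) (P : A -> Prop)
  (c : F) (x : algquot P) : algquot P := qpi P (c *: repr x).

Section AlgQuotientTheory.
Variables (F : comNzRingType) (A : algType F) (P : A -> Prop).
Implicit Types r s t : A.

Local Notation gen_ideal := (gen_ideal P).
Local Notation algquot := (algquot P).
Local Notation qpi := (@qpi F A P).
Local Notation qmul := (@qmul F A P).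
Local Notation qscale := (@qscale F A P).

Lemma qpiP s t : reflect (qpi s = qpi t) (s - t \in gen_ideal).
Proof. by rewrite Quotient.idealrBE qpi.unlock; apply: (iffP eqP). Qed.

Lemma qpiK (x : algquot) : qpi (repr x) = x.
Proof. by rewrite qpi.unlock; exact: reprK. Qed.

Lemma qpiW (Q : algquot -> Prop) : (forall t, Q (qpi t)) -> forall x, Q x.
Proof. by move=> Qt x; rewrite -(qpiK x). Qed.

Lemma qpi_is_zmod_morphism : zmod_morphism qpi.
Proof.
by move=> s t; rewrite qpi.unlock; exact: (raddfB (\pi_(Quotient.quot gen_ideal))).
Qed.

HB.instance Definition _ :=
  GRing.isZmodMorphism.Build A algquot qpi qpi_is_zmod_morphism.

Definition qone : algquot := qpi 1.

Lemma qmulE s t : qmul (qpi s) (qpi t) = qpi (s * t).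
Proof.
rewrite qmul.unlock; set s' := repr _; set t' := repr _.
have es : s' - s \in gen_ideal by apply/qpiP; rewrite qpiK.
have et : t' - t \in gen_ideal by apply/qpiP; rewrite qpiK.
apply/qpiP.
have -> : s' * t' - s * t = (s' - s) * t' + s * (t' - t).
  by rewrite mulrBl mulrBr addrA subrK.
by apply: rpredD; [exact: gen_idealMr | exact: gen_idealMl].
Qed.

Lemma qscaleE c t : qscale c (qpi t) = qpi (c *: t).
Proof.
rewrite qscale.unlock; apply/qpiP; rewrite -scalerBr -mulr_algl.
by apply: gen_idealMl; apply/qpiP; rewrite qpiK.
Qed.

Lemma qmulA : associative qmul.
Proof.
by elim/qpiW=> r; elim/qpiW=> s; elim/qpiW=> t; rewrite !qmulE mulrA.
Qed.

Lemma qmul1 : left_id qone qmul.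
Proof. by elim/qpiW=> r; rewrite qmulE mul1r. Qed.

Lemma qmulr1 : right_id qone qmul.
Proof. by elim/qpiW=> r; rewrite qmulE mulr1. Qed.

Lemma qmulDl : left_distributive qmul +%R.
Proof.
elim/qpiW=> r; elim/qpiW=> s; elim/qpiW=> t.
by rewrite -raddfD !qmulE mulrDl raddfD.
Qed.

Lemma qmulDr : right_distributive qmul +%R.
Proof.
elim/qpiW=> r; elim/qpiW=> s; elim/qpiW=> t.
by rewrite -raddfD !qmulE mulrDr raddfD.
Qed.

(* The ideal may contain 1, so this is only a possibly-zero ring.             *)
HB.instance Definition _ :=
  GRing.Zmodule_isPzRing.Build algquot qmulA qmul1 qmulr1 qmulDl qmulDr.

Lemma qscaleA a b x : qscale a (qscale b x) = qscale (a * b) x.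
Proof. by elim/qpiW: x => t; rewrite !qscaleE scalerA. Qed.

Lemma qscale1 : left_id 1 qscale.
Proof. by elim/qpiW=> t; rewrite qscaleE scale1r. Qed.

Lemma qscaleDr : right_distributive qscale +%R.
Proof.
move=> c; elim/qpiW=> s; elim/qpiW=> t.
by rewrite -raddfD !qscaleE scalerDr raddfD.
Qed.

Lemma qscaleDl x : {morph qscale^~ x : a b / a + b}.
Proof.
by move=> a b; elim/qpiW: x => t; rewrite !qscaleE scalerDl raddfD.
Qed.

HB.instance Definition _ := GRing.Zmodule_isLmodule.Build F algquot
  qscaleA qscale1 qscaleDr qscaleDl.

Lemma qpiM s t : qpi (s * t) = qpi s * qpi t.
Proof. by rewrite -qmulE. Qed.

Lemma qpi1 : qpi 1 = 1.
Proof. by []. Qed.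

HB.instance Definition _ :=
  GRing.isMonoidMorphism.Build A algquot qpi (conj qpi1 qpiM).

Lemma qpiZ : scalable qpi.
Proof. by move=> c t; rewrite -qscaleE. Qed.

HB.instance Definition _ := GRing.isScalable.Build F A algquot *:%R qpi qpiZ.

Lemma qscalerAl c (x y : algquot) : c *: (x * y) = (c *: x) * y.
Proof.
elim/qpiW: x => s; elim/qpiW: y => t.
by rewrite -rmorphM -!linearZ -rmorphM /= scalerAl.
Qed.

Lemma qscalerAr c (x y : algquot) : c *: (x * y) = x * (c *: y).
Proof.
elim/qpiW: x => s; elim/qpiW: y => t.
by rewrite -rmorphM -!linearZ -rmorphM /= scalerAr.
Qed.

End AlgQuotientTheory.

Section Clifford.
Variables (F : fieldType) (m : nat) (B : 'M[F]_m).
Implicit Types v : 'rV[F]_m.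

Definition cliff_rel (t : tensor F m) : Prop :=
  exists v, t = tvec v * tvec v - (bil B v v)%:A.

Definition clifford := algquot cliff_rel.

HB.instance Definition _ := GRing.PzRing.on clifford.
HB.instance Definition _ := GRing.Lmodule.on clifford.

Definition cl_pi (t : tensor F m) : clifford := qpi cliff_rel t.

Definition cl_vec v : clifford := cl_pi (tvec v).

Lemma cl_vec_sqr v : cl_vec v * cl_vec v = bil B v v *: (1 : clifford).
Proof.
rewrite /cl_vec /cl_pi -rmorphM -[1 in RHS](rmorph1 (@qpi F _ cliff_rel)).
by rewrite -linearZ; apply/qpiP; apply: mem_gen_ideal; exists v.
Qed.

Lemma cl_vec_is_linear : linear cl_vec.
Proof. by move=> a u v; rewrite /cl_vec /cl_pi !linearP. Qed.

HB.instance Definition _ :=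
  GRing.isLinear.Build F 'rV[F]_m clifford *:%R cl_vec cl_vec_is_linear.

Lemma cl_vec_anticomm u v : bil B u v + bil B v u = 0 ->
  cl_vec v * cl_vec u = - (cl_vec u * cl_vec v).
Proof.
move=> uv0; apply/eqP; rewrite -addr_eq0; apply/eqP.
have := cl_vec_sqr (u + v).
have -> : cl_vec (u + v) = cl_vec u + cl_vec v by exact: linearD.
rewrite mulrDl !mulrDr !cl_vec_sqr.
have -> : bil B (u + v) (u + v) = bil B u u + bil B v v.
  rewrite -[RHS]addr0 -uv0 /bil linearD !mulmxDl !mulmxDr !mxE.
  by rewrite -!addrA; congr (_ + _); rewrite [RHS]addrC -!addrA.
rewrite scalerDl -addrA => /addrI; rewrite addrA -[X in _ = X -> _]add0r.
by move/addIr; rewrite addrC.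
Qed.

(* The image of the even part of the tensor algebra.                          *)
Definition cl_even (x : clifford) : Prop :=
  exists l : seq (F * seq 'rV[F]_m),
    all (fun p => ~~ odd (size p.2)) l /\
    x = \sum_(p <- l) p.1 *: \prod_(v <- p.2) cl_vec v.

Lemma cl_even0 : cl_even 0.
Proof. by exists [::]; rewrite big_nil. Qed.

Lemma cl_even_lin a x y : cl_even x -> cl_even y -> cl_even (a *: x + y).
Proof.
move=> [l1 [e1 ->]] [l2 [e2 ->]].
exists ([seq (a * p.1, p.2) | p <- l1] ++ l2); split.
  by rewrite all_cat all_map e2 andbT; apply: sub_all e1.
rewrite big_cat /=.
rewrite big_map.
rewrite scaler_sumr.
congr (_ + _).
by apply: eq_bigr => p _; rewrite scalerA.
Qed.

Lemma cl_even1 : cl_even 1.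
Proof. by exists [:: (1, [::])]; rewrite big_seq1 big_nil scale1r. Qed.

Lemma cl_even_vecM u v : cl_even (cl_vec u * cl_vec v).
Proof.
exists [:: (1, [:: u; v])].
by rewrite big_seq1 big_cons big_seq1 scale1r.
Qed.

Lemma cl_evenM x y : cl_even x -> cl_even y -> cl_even (x * y).
Proof.
move=> [l1 [e1 ->]] [l2 [e2 ->]].
exists [seq (p.1 * p'.1, p.2 ++ p'.2) | p <- l1, p' <- l2]; split.
  apply/allP=> _ /allpairsP[[p p'] /= [pl1 p'l2 ->]] /=.
  by rewrite size_cat oddD (negbTE (allP e1 _ pl1)) (allP e2 _ p'l2).
rewrite big_allpairs_dep mulr_suml; apply: eq_bigr => p _.
rewrite mulr_sumr; apply: eq_bigr => p' _.
by rewrite big_cat -qscalerAl -qscalerAr scalerA.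
Qed.

End Clifford.

Section CliffordMap.
Variables (F : fieldType) (m m' : nat) (B : 'M[F]_m) (B' : 'M[F]_m').
Variable M : 'M[F]_(m, m').

Definition word_map (w : {fmonom 'I_m}) : tensor F m' :=
  \prod_(i <- (w : seq 'I_m)) tvec (row i M).

Lemma word_map_mmorphism : mmorphism word_map.
Proof.
split=> [w1 w2|]; rewrite /word_map ?fm1 ?big_nil // fmM big_cat //.
Qed.

HB.instance Definition _ :=
  isMultiplicative.Build {fmonom 'I_m} (tensor F m') word_map
    word_map_mmorphism.

Definition tmap : tensor F m -> tensor F m' :=
  mmap (@malgC {fmonom 'I_m'} F) word_map.

(* The algebra morphism Cl(B) -> Cl(B') induced by v |-> v *m M, provided     *)
(* that v |-> v *m M preserves the quadratic forms (lemmas cl_mapE, cl_map_vec*)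
(* and cl_mapM); repr is a representative in the tensor algebra.              *)
Definition cl_map (x : clifford B) : clifford B' := cl_pi B' (tmap (repr x)).

Lemma tmapM s t : tmap (s * t) = tmap s * tmap t.
Proof.
have cm g (w w' : {fmonom 'I_m}) :
    GRing.comm (@malgC {fmonom 'I_m'} F (mcoeff w g)) (word_map w').
  exact: malgC_comm.
exact: (commr_mmap_is_multiplicative cm).1.
Qed.

Lemma tmapB s t : tmap (s - t) = tmap s - tmap t.
Proof. exact: mmapB. Qed.

Lemma tmapD s t : tmap (s + t) = tmap s + tmap t.
Proof. exact: mmapD. Qed.

Lemma tmap_sum I (r : seq I) (E : I -> tensor F m) :
  tmap (\sum_(i <- r) E i) = \sum_(i <- r) tmap (E i).
Proof. exact: (raddf_sum (mmap (@malgC {fmonom 'I_m'} F) word_map)). Qed.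

Lemma tmapZ c t : tmap (c *: t) = c *: tmap t.
Proof. by rewrite /tmap mmapZ mul_malgC. Qed.

Lemma tmap1 : tmap 1 = 1.
Proof. exact: mmap1. Qed.

Lemma tmap_vec v : tmap (tvec v) = tvec (v *m M).
Proof.
rewrite mulmx_sum_row linear_sum tvec.unlock tmap_sum; apply: eq_bigr => i _.
by rewrite /tmap mmapU /word_map fmU big_seq1 mul_malgC linearZ.
Qed.

Hypothesis isoM : forall v, bil B' (v *m M) (v *m M) = bil B v v.

Lemma cl_mapE t : cl_map (cl_pi B t) = cl_pi B' (tmap t).
Proof.
apply/qpiP; rewrite -tmapB.
have /asboolP[l [Pl ->]] : repr (cl_pi B t) - t \in gen_ideal (cliff_rel B).
  by apply/qpiP; rewrite qpiK.
rewrite tmap_sum; apply/asboolP.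
exists [seq (tmap x.1.1, tmap x.1.2, tmap x.2) | x <- l]; split.
  move=> _ /mapP[x /Pl[v xv] ->] /=; exists (v *m M).
  by rewrite xv tmapB tmapM tmapZ tmap1 tmap_vec isoM.
by rewrite big_map; apply: eq_bigr => x _; rewrite !tmapM.
Qed.

Lemma cl_map_vec v : cl_map (cl_vec B v) = cl_vec B' (v *m M).
Proof. by rewrite cl_mapE tmap_vec. Qed.

Lemma cl_map_is_linear : linear cl_map.
Proof.
move=> a; elim/qpiW=> s; elim/qpiW=> t.
rewrite -linearP -!/(cl_pi B _) !cl_mapE /cl_pi -linearP; congr (qpi _ _).
by rewrite tmapD tmapZ.
Qed.

Lemma cl_mapM x y : cl_map (x * y) = cl_map x * cl_map y.
Proof.
elim/qpiW: x => s; elim/qpiW: y => t.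
by rewrite -rmorphM -!/(cl_pi B _) !cl_mapE tmapM /cl_pi rmorphM.
Qed.

Lemma cl_map1 : cl_map 1 = 1.
Proof. by rewrite -(qpi1 (cliff_rel B)) -/(cl_pi B _) cl_mapE tmap1. Qed.

Lemma cl_map_even x : cl_even x -> cl_even (cl_map x).
Proof.
case=> l [le ->]; exists [seq (p.1, [seq v *m M | v <- p.2]) | p <- l]; split.
  by rewrite all_map; apply: sub_all le => p /=; rewrite size_map.
have map0 : cl_map 0 = 0.
  by have := cl_map_is_linear (-1) 0 0; rewrite scaler0 addr0 scaleN1r addNr.
have mapD y z : cl_map (y + z) = cl_map y + cl_map z.
  by have := cl_map_is_linear 1 y z; rewrite !scale1r.
have mapZ c y : cl_map (c *: y) = c *: cl_map y.
  by have := cl_map_is_linear c y 0; rewrite map0 !addr0.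
rewrite big_map (big_morph _ mapD map0); apply: eq_bigr => p _; rewrite mapZ /=.
congr (_ *: _); elim: p.2 => [|v r IHr]; first by rewrite !big_nil cl_map1.
by rewrite !big_cons cl_mapM IHr cl_map_vec.
Qed.

End CliffordMap.

Section Spinors.
Variables (F : fieldType) (n : nat).

(* The basis vectors are ordered e_1, ..., e_n, f_1, ..., f_n.                *)
Definition hyp : 'M[F]_(n + n) := block_mx 0 1%:M 1%:M 0.

Definition Cl := clifford hyp.
HB.instance Definition _ := GRing.PzRing.on Cl.
HB.instance Definition _ := GRing.Lmodule.on Cl.

Definition evec (i : 'I_n) : 'rV[F]_(n + n) := delta_mx 0 (lshift n i).
Definition fvec (i : 'I_n) : 'rV[F]_(n + n) := delta_mx 0 (rshift n i).

Definition fprod : Cl := \prod_(i < n) cl_vec hyp (fvec i).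

(* Cl(V_n) f *)
Definition spinor_pred : {pred Cl} := fun x => `[< exists a, x = a * fprod >].

Lemma spinor_submod : submod_closed spinor_pred.
Proof.
split; first by apply/asboolP; exists 0; rewrite mul0r.
move=> c _ _ /asboolP[a ->] /asboolP[b ->]; apply/asboolP.
by exists (c *: a + b); rewrite mulrDl qscalerAl.
Qed.

HB.instance Definition _ :=
  GRing.isSubmodClosed.Build F Cl spinor_pred spinor_submod.

Record spinor := Spinor { spinor_val : Cl; _ : spinor_val \in spinor_pred }.

HB.instance Definition _ := [isSub for spinor_val].
HB.instance Definition _ := [Choice of spinor by <:].
HB.instance Definition _ := [SubChoice_isSubLmodule of spinor by <:].

(* Cl^+(V_n) f *)
Definition halfspin_pred : {pred Cl} :=
  fun x => `[< exists2 a : Cl, cl_even a & x = a * fprod >].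

Lemma halfspin_submod : submod_closed halfspin_pred.
Proof.
split; first by apply/asboolP; exists 0; rewrite ?mul0r //; exact: cl_even0.
move=> c _ _ /asboolP[a ea ->] /asboolP[b eb ->]; apply/asboolP.
exists (c *: a + b); first exact: cl_even_lin.
by rewrite mulrDl qscalerAl.
Qed.

HB.instance Definition _ :=
  GRing.isSubmodClosed.Build F Cl halfspin_pred halfspin_submod.

Record halfspin :=
  HalfSpin { halfspin_val : Cl; _ : halfspin_val \in halfspin_pred }.

HB.instance Definition _ := [isSub for halfspin_val].
HB.instance Definition _ := [Choice of halfspin by <:].
HB.instance Definition _ := [SubChoice_isSubLmodule of halfspin by <:].

Lemma halfspin_is_spinor (w : halfspin) : halfspin_val w \in spinor_pred.
Proof. by case: w => x /= /asboolP[a _ ->]; apply/asboolP; exists a. Qed.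

Definition halfspin_spinor (w : halfspin) : spinor :=
  Spinor (halfspin_is_spinor w).

Lemma spinor_act_subproof (a : Cl) (s : spinor) :
  a * spinor_val s \in spinor_pred.
Proof.
by case: s => x /= /asboolP[b ->]; apply/asboolP; exists (a * b); rewrite mulrA.
Qed.

Definition spinor_act (a : Cl) (s : spinor) : spinor :=
  Spinor (spinor_act_subproof a s).

(* E = exp T; T is required to be nilpotent, so that the series is finite.    *)
Definition is_exp (W : lmodType F) (T E : W -> W) : Prop :=
  exists N, (forall w, iter N T w = 0) /\
    (forall w, E w = \sum_(k < N) (k`!%:R)^-1 *: iter k T w).

(* The image of u /\ v under so(V_n) -> Cl^+(V_n).                            *)
Definition wedge (u v : 'rV[F]_(n + n)) : Cl :=
  4%:R^-1 *: (cl_vec hyp u * cl_vec hyp v - cl_vec hyp v * cl_vec hyp u).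

Definition root_vector (X : Cl) : Prop :=
  exists i j : 'I_n, i != j /\
    [\/ X = wedge (evec i) (evec j), X = wedge (fvec i) (fvec j)
      | X = wedge (evec i) (fvec j)].

(* The subgroup of GL(Cl(V_n) f) generated by the exp(t X), X a root vector.  *)
Inductive Spin : (spinor -> spinor) -> Prop :=
| Spin_exp (t : F) X g :
    root_vector X -> is_exp (spinor_act (t *: X)) g -> Spin g
| Spin_id : Spin id
| Spin_comp g h : Spin g -> Spin h -> Spin (g \o h)
| Spin_inv g h : Spin g -> cancel g h -> cancel h g -> Spin h.

Lemma root_vector_sqr X : root_vector X -> X * X = 0 /\ cl_even X.
Proof.
have wX u v : bil hyp u u = 0 -> bil hyp v v = 0 ->
    bil hyp u v + bil hyp v u = 0 ->
    wedge u v * wedge u v = 0 /\ cl_even (wedge u v).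
  move=> uu vv uv; have ba := cl_vec_anticomm uv.
  have abab : cl_vec hyp u * cl_vec hyp v * (cl_vec hyp u * cl_vec hyp v) = 0.
    rewrite mulrA -(mulrA (cl_vec hyp u)) ba mulrN mulNr mulrA cl_vec_sqr uu.
    by rewrite scale0r !mul0r oppr0.
  split.
    rewrite /wedge ba opprK -qscalerAl -qscalerAr mulrDl !mulrDr abab.
    by rewrite !addr0 !scaler0.
  rewrite /wedge -[_ *: _]addr0; apply: cl_even_lin; last exact: cl_even0.
  rewrite -[_ * _ in X in cl_even X]scale1r addrC -scaleN1r.
  apply: cl_even_lin; first exact: cl_even_vecM.
  by rewrite scale1r; exact: cl_even_vecM.
have bE a b : bil hyp (delta_mx 0 a) (delta_mx 0 b) = hyp a b.
  by rewrite /bil -rowE trmx_delta -colE !mxE.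
case=> i [j [ij]]; have ji : j == i = false by rewrite eq_sym (negbTE ij).
case=> ->; apply: wX; rewrite !bE /hyp /evec /fvec
  ?(block_mxEul, block_mxEur, block_mxEdl, block_mxEdr) !mxE ?addr0 //.
by rewrite (negbTE ij) ji addr0.
Qed.

Lemma Spin_act g : Spin g -> exists c d : Cl,
  [/\ cl_even c, cl_even d, c * d = 1, d * c = 1
    & forall s, spinor_val (g s) = c * spinor_val s].
Proof.
elim=> {g} [t X g rX [N [nilN gE]]||g h _ [c [d [ec ed cd dc gE]]]
            _ [c' [d' [ec' ed' cd' dc' hE]]]
          |g h _ [c [d [ec ed cd dc gE]]] gh hg].
- have [XX eX] := root_vector_sqr rX; set T := t *: X in nilN gE.
  have TT : T * T = 0 by rewrite -qscalerAl -qscalerAr XX !scaler0.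
  exists (T + 1), (- T + 1); split.
  + exact/cl_even_lin/cl_even1.
  + by rewrite -scaleNr; exact/cl_even_lin/cl_even1.
  + by rewrite mulrDl mul1r mulrDr mulr1 mulrN TT oppr0 add0r addrA subrr add0r.
  + by rewrite mulrDl mul1r mulrDr mulr1 mulNr TT oppr0 add0r addrA addNr add0r.
  move=> s; rewrite gE mulrDl mul1r.
  have act2 k (r : spinor) : iter k.+2 (spinor_act T) r = 0.
    elim: k => [|k IHk].
      by apply: val_inj; rewrite /= mulrA TT mul0r.
    by rewrite iterS IHk; apply: val_inj; rewrite /= mulr0.
  case: N nilN {gE} => [|[|N]] nilN.
  + have /= -> := nilN s.
    by rewrite big_ord0 mulr0 addr0.
  + have /(congr1 spinor_val) /= -> := nilN s.
    by rewrite big_ord1 fact0 invr1 scale1r add0r.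
  rewrite !big_ord_recl big1 => [|k _]; last by rewrite act2 scaler0.
  by rewrite addr0 /= !invr1 !scale1r addrC.
- by exists 1, 1; split=> [||||s]; rewrite ?mul1r //; exact: cl_even1.
- exists (c * c'), (d' * d); split.
  + exact: cl_evenM.
  + exact: cl_evenM.
  + by rewrite mulrA -(mulrA c) cd' mulr1.
  + by rewrite mulrA -(mulrA d') dc mulr1.
  + by move=> s; rewrite /= gE hE mulrA.
exists d, c; split=> // s.
by rewrite -{2}[s]hg gE mulrA dc mul1r.
Qed.

Lemma Spin_halfspin g w :
  Spin g -> spinor_val (g (halfspin_spinor w)) \in halfspin_pred.
Proof.
case/Spin_act=> c [_ [ec _ _ _ ->]]; case: w => x /= /asboolP[a ea ->].
by apply/asboolP; exists (c * a); [exact: cl_evenM | rewrite mulrA].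
Qed.

(* The action of g on Cl^+(V_n) f, which is stable under the spin group (see  *)
(* Spin_halfspin); the default value 0 of insubd is not used for such g.      *)
Definition halfspin_act (g : spinor -> spinor) (w : halfspin) : halfspin :=
  insubd 0 (spinor_val (g (halfspin_spinor w))).

Definition isotropic (H : {vspace 'rV[F]_(n + n)}) : Prop :=
  {in H &, forall u v, bil hyp u v = 0}.

(* The union of the lines S_H, H isotropic of dimension n.                    *)
Definition Gr_iso (s : spinor) : Prop :=
  exists H : {vspace 'rV[F]_(n + n)},
    [/\ \dim H = n, isotropic H
      & {in H, forall v, spinor_act (cl_vec hyp v) s = 0}].

Definition Gr_iso_plus (w : halfspin) : Prop := Gr_iso (halfspin_spinor w).

(* The exterior algebra of E_n is the Clifford algebra of the zero form.      *)
Definition Ext := clifford (0 : 'M[F]_n).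
HB.instance Definition _ := GRing.PzRing.on Ext.
HB.instance Definition _ := GRing.Lmodule.on Ext.

(* The identification of the even part of the exterior algebra of E_n with    *)
(* Cl^+(V_n) f, sending omega to omega f.                                     *)
Definition ext_spinor (omega : Ext) : halfspin :=
  insubd 0 (cl_map hyp (row_mx 1%:M 0) omega * fprod).

Lemma ext_spinorE omega : cl_even omega ->
  halfspin_val (ext_spinor omega) = cl_map hyp (row_mx 1%:M 0) omega * fprod.
Proof.
move=> e; apply: (@insubdK _ halfspin_pred); apply/asboolP.
exists (cl_map hyp (row_mx 1%:M 0) omega) => //; apply: cl_map_even e => v.
rewrite /bil mulmx0 mul0mx mul_mx_row mulmx1 mulmx0 /hyp mul_row_block.
by rewrite !mulmx0 !mul0mx mulmx1 !addr0 tr_row_mx mul_row_col trmx0 mulmx0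
  mul0mx addr0.
Qed.

(* The inverse of the bijection omega |-> omega f from the even part of the   *)
(* exterior algebra to Cl^+(V_n) f.                                           *)
Definition spinor_ext (w : halfspin) : Ext :=
  if pselect (exists omega : Ext, cl_even omega /\ ext_spinor omega = w)
    is left h then projT1 (cid h) else 0.

End Spinors.

(* The map induced by E_n -> E_m, e_i |-> e_i for i < m and e_i |-> 0 for     *)
(* i >= m, under the identifications above.                                   *)
Definition spin_proj (F : fieldType) n m (w : halfspin F n) : halfspin F m :=
  ext_spinor (cl_map (0 : 'M[F]_m) (pid_mx m : 'M[F]_(n, m)) (spinor_ext w)).

Section CoordinateRing.
Variables (F : fieldType) (W : lmodType F).
Implicit Types (phi : W -> F) (J : (W -> F) -> Prop).

(* The coordinate ring of W is represented as the ring of polynomial functions*)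
(* on W, i.e. polynomials in finitely many linear forms; this is the symmetric*)
(* algebra of the dual of W when W is finite-dimensional and F is infinite.   *)
Definition polyfun phi : Prop :=
  exists N (l : 'I_N -> {linear W -> F^o}) (p : mpoly N F),
    forall w, phi w = p.@[fun i => l i w : F].

Definition vanishing_ideal (X : W -> Prop) phi : Prop :=
  polyfun phi /\ forall w, X w -> phi w = 0.

Definition ideal_span (G : (W -> F) -> Prop) phi : Prop :=
  exists N (a g : 'I_N -> W -> F),
    (forall i, polyfun (a i) /\ G (g i)) /\
    forall w, phi w = \sum_(i < N) a i w * g i w.

Definition radical J phi : Prop :=
  polyfun phi /\ exists k : nat, J (fun w => phi w ^+ k).

Definition zero_locus J (w : W) : Prop := forall phi, J phi -> phi w = 0.

End CoordinateRing.

(* The union of the orbits of the pullbacks along pi_{n,m} of the elements of *)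
(* I, for the action (g . phi)(w) = phi(g^-1 w).                              *)
Definition Spin_orbits (F : fieldType) n m (I : (halfspin F m -> F) -> Prop)
    (phi : halfspin F n -> F) : Prop :=
  exists p g ginv, [/\ I p, Spin g, cancel g ginv, cancel ginv g
    & phi = fun w => p (spin_proj m (halfspin_act ginv w))].

(* Main.v *)
Require Import Defs.
From HB Require Import structures.
From mathcomp Require Import all_boot all_order all_algebra.
From mathcomp Require Import mpoly monalg.
From mathcomp Require Import boolp ring.

(* The spinors of Cl^+(V_n) f are identified with functions on the subsets of *)
(* {1..n} (the Fock space), on which e_i and f_i act by creation and          *)
(* annihilation; the coordinates of y are <f_i1 ... f_ik y>, the values at    *)
(* the empty set. For n = 4, writing out v y = 0 for one nonzero v shows that *)
(* pure y satisfy the quadric                                                 *)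
(*   <y><f_a f_b f_c f_d y> = <ab><cd> - <ac><bd> + <ad><bc>,                 *)
(* where <ab> stands for <f_a f_b y>.                                         *)
(* Conversely, if this quadric, pulled back to V_n, vanishes on the Spin-orbit*)
(* of y <> 0, then, since replacing y by (1 + e_a f_l) y exchanges indices,   *)
(* all quadrics (a, b, c, d) vanish on the orbit. Elements 1 + f_i f_j make   *)
(* <y> nonzero, and then elements 1 + t e_i e_j make all <ij> zero. A nonzero *)
(* coordinate of minimal positive degree 2k would now be moved to degree 4 by *)
(* k - 2 elements 1 + f_i f_j, where the quadric forbids it. So the orbit     *)
(* contains a multiple of f, which is pure, and purity is Spin-invariant.     *)
(* For the other inclusion, the projection to V_4 maps pure spinors to pure   *)
(* spinors: it is the reduction of H by the isotropic space <e_5, ..., e_n>.  *)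

Set Implicit Arguments.
Unset Strict Implicit.
Unset Printing Implicit Defensive.

Import GRing.Theory.
Local Open Scope ring_scope.

(** Both inclusions go through the single quadric [wick], which says that a degree 4 coefficient of
    a spinor is the Pfaffian of its degree 2 coefficients. The map [to_fock] moves the question to
    the Fock space: it is injective on even spinors and turns Clifford multiplication by vectors
    into [fock_act]. By [Gr_iso_plusE], lying in the cone then means being zero or being killed by
    an n-dimensional space of vectors ([fock_pure]).

    Pure spinors satisfy the equations because purity is preserved by the spin group ([Spin_pure])
    and by the projection to [V_4]. On the Fock space this projection is restriction to the subsets
    of the first four indices ([to_fock_spin_proj], [restr_pure]). Hence every generator of the
    ideal, and every element of its radical, vanishes at a pure spinor.

    Conversely, [pure_wick] puts the quadric into the ideal of the cone for [V_4], so at a common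
    zero [w] the pulled-back quadric vanishes on the whole spin orbit of [w]. By [wick_orbit_vac]
    the orbit of a nonzero [w] then meets the line of the vacuum: the group can make the degree 0
    coefficient nonzero and the degree 2 coefficients zero, after which the quadrics force all
    higher coefficients to vanish. The vacuum is killed by all f_i, so it is pure, and purity is
    carried back to [w] ([wick_Spin_pure]). *)

Notation fock F n := {ffun {set 'I_n} -> F^o}.

(** * Creation and annihilation operators and their anticommutation relations *)

Section FockGenerators.
Variables (F : fieldType) (n : nat).
Local Notation M := (fock F n).
Implicit Types (i j k : 'I_n) (S : {set 'I_n}) (x y : M).

(** The sign of sorting e_i into the increasing exterior monomial indexed by [S]. *)
Definition fsign i S : F := (-1) ^+ #|[set j in S | (j < i)%N]|.

Definition crea i x : M :=
  [ffun S : {set 'I_n} => if i \in S then fsign i S * x (S :\ i) else 0].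

(** The factor 2 reflects uv + vu = 2 (u|v): f_i acts as twice the contraction with e_i. *)
Definition anni i x : M :=
  [ffun S : {set 'I_n} => if i \in S then 0 else 2%:R * fsign i S * x (i |: S)].

Lemma crea_is_linear i : linear (crea i).
Proof.
move=> a x y; apply/ffunP=> S; rewrite !ffunE; case: ifP => _.
  by rewrite /GRing.scale /=; ring.
by rewrite scaler0 addr0.
Qed.
HB.instance Definition _ i :=
  GRing.isLinear.Build F M M *:%R (crea i) (crea_is_linear i).

Lemma anni_is_linear i : linear (anni i).
Proof.
move=> a x y; apply/ffunP=> S; rewrite !ffunE; case: ifP => _.
  by rewrite scaler0 addr0.
by rewrite /GRing.scale /=; ring.
Qed.
HB.instance Definition _ i :=
  GRing.isLinear.Build F M M *:%R (anni i) (anni_is_linear i).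

Lemma fsignU1 i j S : i \notin S ->
  fsign j (i |: S) = (if (i < j)%N then -1 else 1) * fsign j S.
Proof.
move=> iS; rewrite /fsign; case: ifP => ij.
  rewrite -exprS; congr (_ ^+ _).
  rewrite (_ : [set k in i |: S | (k < j)%N] = i |: [set k in S | (k < j)%N]).
    by rewrite cardsU1 !inE (negbTE iS).
  by apply/setP=> k; rewrite !inE; case: eqP => // ->; rewrite ij.
rewrite mul1r; congr (_ ^+ _); apply: eq_card => k; rewrite !inE.
by case: eqP => // ->; rewrite ij (negbTE iS).
Qed.

Lemma fsignD1 i j S : i \in S ->
  fsign j (S :\ i) = (if (i < j)%N then -1 else 1) * fsign j S.
Proof.
move=> iS; rewrite -{2}(setD1K iS) fsignU1 ?setD11 // mulrA.
by case: ifP; rewrite ?mul1r // mulrNN mulr1 mul1r.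
Qed.

Lemma fsign_sqr i S : fsign i S * fsign i S = 1.
Proof. by rewrite -expr2 sqrr_sign. Qed.

Lemma crea_anticomm i j x : crea i (crea j x) = - crea j (crea i x).
Proof.
apply/ffunP=> S; rewrite !ffunE !inE.
case iS: (i \in S); case jS: (j \in S); rewrite ?andbF ?mulr0 ?oppr0 //= !andbT.
have [->|ij] := eqVneq i j; first by rewrite mulr0 oppr0.
rewrite /= !fsignD1 // [S :\ j :\ i]setDDl setUC -setDDl.
case: (ltngtP i j) => [_|_|/val_inj eij]; try by ring.
by move: ij; rewrite eij eqxx.
Qed.

Lemma anni_anticomm i j x : anni i (anni j x) = - anni j (anni i x).
Proof.
apply/ffunP=> S; rewrite !ffunE !inE.
case iS: (i \in S); case jS: (j \in S);
  rewrite ?orbT ?orbF ?mulr0 ?oppr0 //.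
have [->|ij] := eqVneq i j; first by rewrite mulr0 oppr0.
rewrite /= !fsignU1 ?iS ?jS //.
rewrite [i |: (j |: S)]setUCA.
case: (ltngtP i j) => [_|_|/val_inj eij]; try by ring.
by move: ij; rewrite eij eqxx.
Qed.

Lemma anni_crea i j x :
  anni i (crea j x) = (if i == j then 2%:R else 0) *: x - crea j (anni i x).
Proof.
apply/ffunP=> S; rewrite !ffunE /= !inE.
have [<-{j}|ij] := eqVneq i j.
  rewrite /=; case: ifP => iS.
    rewrite setD1K // fsignD1 // ltnn.
    rewrite /GRing.scale /= mul1r.
    transitivity (2%:R * x S - 2%:R * (fsign i S * fsign i S) * x S);
      last by ring.
    by rewrite fsign_sqr mulr1 subrr.
  rewrite setU1K ?iS // fsignU1 ?iS // ltnn mul1r subr0 /GRing.scale /=.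
  transitivity (2%:R * (fsign i S * fsign i S) * x S); first by ring.
  by rewrite fsign_sqr mulr1.
rewrite scale0r add0r /=.
case: ifP => iS.
  by case: ifP; rewrite ?mulr0 oppr0.
case: ifP => jS; last by rewrite mulr0 oppr0.
rewrite fsignU1 ?iS // fsignD1 //.
have -> : (i |: S) :\ j = i |: S :\ j.
  by apply/setP=> k; rewrite !inE; case: (eqVneq k i) => [->|//]; rewrite ij.
case: (ltngtP i j) => [_|_|/val_inj eij]; try by ring.
by move: ij; rewrite eij eqxx.
Qed.

End FockGenerators.

Arguments crea {F n}.
Arguments anni {F n}.

(* Locked to keep unification from matching [fock_act v x] with a sum.        *)
HB.lock Definition fock_act (F : fieldType) (n : nat) (v : 'rV[F]_(n + n))
    (x : fock F n) : fock F n :=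
  \sum_i v 0 (lshift n i) *: crea i x + \sum_i v 0 (rshift n i) *: anni i x.
Arguments fock_act {F n}.

(** * The Clifford action on the Fock space, and coefficients *)

Section Fock.
Variables (F : fieldType) (n : nat).
Local Notation M := (fock F n).
Implicit Types (i j k : 'I_n) (S : {set 'I_n}) (v : 'rV[F]_(n + n)) (x y : M).

Lemma fock_act_is_linear v : linear (fock_act v).
Proof.
move=> a x y; rewrite fock_act.unlock scalerDr !scaler_sumr addrACA -!big_split /=.
apply: eq_bigr => i _; rewrite !(linearP (crea i)) !(linearP (anni i)) !scalerDr !scalerA.
by rewrite ![_ * a]mulrC.
Qed.
HB.instance Definition _ v :=
  GRing.isLinear.Build F M M *:%R (fock_act v) (fock_act_is_linear v).

Lemma fock_act_linl x : linear (fock_act^~ x).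
Proof.
move=> a u v; rewrite fock_act.unlock scalerDr !scaler_sumr addrACA -!big_split /=.
by apply: eq_bigr => i _; rewrite !mxE !scalerDl !scalerA.
Qed.

Lemma fock_act_evec i x : fock_act (evec F i) x = crea i x.
Proof.
rewrite fock_act.unlock [X in _ + X]big1 => [|j _]; last first.
  by rewrite mxE eq_rlshift andbF scale0r.
rewrite addr0 (bigD1 i) //= big1 => [|j ji].
  by rewrite mxE !eqxx scale1r addr0.
by rewrite mxE eq_lshift (negbTE ji) andbF scale0r.
Qed.

Lemma fock_act_fvec i x : fock_act (fvec F i) x = anni i x.
Proof.
rewrite fock_act.unlock [X in X + _]big1 => [|j _]; last first.
  by rewrite mxE eq_lrshift andbF scale0r.
rewrite add0r (bigD1 i) //= big1 => [|j ji].
  by rewrite mxE !eqxx scale1r addr0.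
by rewrite mxE eq_rshift (negbTE ji) andbF scale0r.
Qed.

Lemma bil_hyp (u v : 'rV[F]_(n + n)) : bil (hyp F n) u v =
  \sum_i (u 0 (lshift n i) * v 0 (rshift n i) + u 0 (rshift n i) * v 0 (lshift n i)).
Proof.
rewrite /bil /hyp -[u]hsubmxK -[v]hsubmxK mul_row_block !mulmx0 !mulmx1.
rewrite add0r addr0 tr_row_mx mul_row_col mxE !mxE -big_split.
by apply: eq_bigr => i _; rewrite !row_mxEl !row_mxEr !mxE addrC.
Qed.

Hypothesis two_neq0 : 2%:R != 0 :> F.

Let antisym_sum0 (E : 'I_n -> 'I_n -> M) :
  (forall i j, E i j = - E j i) -> \sum_i \sum_j E i j = 0.
Proof.
move=> antiE; set s := LHS.
have sN : s = - s.
  rewrite {1}/s exchange_big -sumrN; apply: eq_bigr => i _.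
  by rewrite -sumrN; apply: eq_bigr => j _; rewrite antiE.
have : 2%:R *: s = 0 by rewrite scaler_nat mulr2n {1}sN addNr.
by move/eqP; rewrite scaler_eq0 (negbTE two_neq0) => /eqP.
Qed.

(** The creation part [E] and the annihilation part [A] of [v] square to zero by antisymmetry, and
    in EA + AE only the diagonal contractions of [anni_crea] survive. *)
Lemma fock_act_sqr v x : fock_act v (fock_act v x) = bil (hyp F n) v v *: x.
Proof.
set E := fun y : M => \sum_i v 0 (lshift n i) *: crea i y.
set A := fun y : M => \sum_i v 0 (rshift n i) *: anni i y.
have actE y : fock_act v y = E y + A y by rewrite fock_act.unlock.
have ED y z : E (y + z) = E y + E z.
  by rewrite -big_split; apply: eq_bigr => i _; rewrite linearD scalerDr.
have AD y z : A (y + z) = A y + A z.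
  by rewrite -big_split; apply: eq_bigr => i _; rewrite linearD scalerDr.
have EE : E (E x) = 0.
  rewrite -[RHS](@antisym_sum0 (fun i j =>
    (v 0 (lshift n i) * v 0 (lshift n j)) *: crea i (crea j x))).
    apply: eq_bigr => i _; rewrite linear_sum scaler_sumr; apply: eq_bigr => j _.
    by rewrite linearZ scalerA.
  by move=> i j; rewrite crea_anticomm scalerN mulrC.
have AA : A (A x) = 0.
  rewrite -[RHS](@antisym_sum0 (fun i j =>
    (v 0 (rshift n i) * v 0 (rshift n j)) *: anni i (anni j x))).
    apply: eq_bigr => i _; rewrite linear_sum scaler_sumr; apply: eq_bigr => j _.
    by rewrite linearZ scalerA.
  by move=> i j; rewrite anni_anticomm scalerN mulrC.
have EA : E (A x) = \sum_i \sum_j (v 0 (rshift n i) * v 0 (lshift n j)) *: crea j (anni i x).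
  rewrite exchange_big; apply: eq_bigr => j _; rewrite linear_sum scaler_sumr.
  by apply: eq_bigr => i _; rewrite linearZ scalerA mulrC.
have AE : A (E x) = \sum_i \sum_j (v 0 (rshift n i) * v 0 (lshift n j)) *: anni i (crea j x).
  apply: eq_bigr => i _; rewrite linear_sum scaler_sumr.
  by apply: eq_bigr => j _; rewrite linearZ scalerA.
rewrite !actE ED AD EE AA add0r addr0 bil_hyp AE EA -big_split scaler_suml.
apply: eq_bigr => i _; rewrite -big_split (bigD1 i) //= big1 => [|j ji].
  rewrite addr0 anni_crea eqxx -scalerDr [X in _ *: X]addrC subrK scalerA; congr (_ *: _); ring.
by rewrite anni_crea eq_sym (negbTE ji) scale0r sub0r scalerN subrr.
Qed.

Definition annis (l : seq 'I_n) x : M := foldr anni x l.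
(** Up to a nonzero factor this is the value of [x] at the set of entries of a duplicate-free [l]
    ([annisE]). With lists the signs are governed by order: swapping neighbours negates, and a
    repeated entry gives 0. *)
Definition coef l x : F := annis l x set0.

Lemma coef_is_linear l : linear (coef l : M -> F^o).
Proof.
have lin a x y : annis l (a *: x + y) = a *: annis l x + annis l y.
  by elim: l => //= i l ->; rewrite linearP.
by move=> a x y; rewrite /coef lin !ffunE.
Qed.
HB.instance Definition _ l :=
  GRing.isLinear.Build F M F^o *:%R (coef l) (coef_is_linear l).

Lemma annis_mem i l x S : i \in l -> i \in S -> annis l x S = 0.
Proof.
elim: l S => //= j l IHl S; rewrite inE => /orP[/eqP<-|il] iS.
  by rewrite ffunE iS.
by rewrite ffunE; case: ifP => // _; rewrite IHl ?mulr0 // !inE iS orbT.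
Qed.

Lemma annis_nuniq l x : ~~ uniq l -> annis l x = 0.
Proof.
elim: l => //= i l IHl; rewrite negb_and negbK => /orP[il|/IHl->].
  apply/ffunP=> S; rewrite !ffunE; case: ifP => // _.
  by rewrite (annis_mem _ il) ?mulr0 // setU11.
by rewrite linear0.
Qed.

Lemma annisE l x S : uniq l -> (forall i, i \in l -> i \notin S) ->
  exists2 c : F, c != 0 & annis l x S = c * x ([set i in l] :|: S).
Proof.
elim: l S => [|i l IHl] S /=.
  move=> _ _; exists 1; rewrite ?oner_eq0 // mul1r; congr (x _).
  by apply/setP=> i; rewrite !inE.
move=> /andP[il ul] lS.
rewrite ffunE (negbTE (lS _ (mem_head _ _))).
have [|c c0 E] := IHl (i |: S) ul.
  move=> j jl; rewrite !inE negb_or lS ?inE ?jl ?orbT // andbT.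
  by apply: contraNneq il => <-.
exists (2%:R * fsign F i S * c).
  by rewrite !mulf_neq0 ?signr_eq0.
rewrite -/(annis l x) E mulrA; congr (_ * x _).
by apply/setP=> j; rewrite !inE; case: eqP => // _; rewrite orbT.
Qed.

Lemma coef_inj x : (forall l, uniq l -> coef l x = 0) -> x = 0.
Proof.
move=> x0; apply/ffunP=> S; rewrite ffunE.
have [|c c0 E] := @annisE (enum S) x set0 (enum_uniq _).
  by move=> i; rewrite inE.
have := x0 _ (enum_uniq (mem S)); rewrite /coef E setU0 => /eqP.
by rewrite mulf_eq0 (negbTE c0) set_enum => /eqP.
Qed.

Definition vac : M := [ffun S => (S == set0)%:R].

Lemma anni_vac i : anni i vac = 0.
Proof.
apply/ffunP=> S; rewrite !ffunE; case: ifP => // _.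
by rewrite -subset0 subUset sub1set inE /= mulr0.
Qed.

Lemma coef_crea i x : coef [::] (crea i x) = 0.
Proof. by rewrite /coef /= ffunE inE. Qed.

Lemma coef_vac i l : coef (rcons l i) vac = 0.
Proof.
rewrite /coef /annis -cats1 foldr_cat /= anni_vac.
by rewrite -[RHS](linear0 (coef l)).
Qed.

Lemma coef_nil_vac : coef [::] vac = 1.
Proof. by rewrite /coef /= ffunE eqxx. Qed.

Lemma annis_enum x : annis (index_enum 'I_n) x = coef (index_enum 'I_n) x *: vac.
Proof.
apply/ffunP=> S; rewrite !ffunE; have [->|[i iS]] := set_0Vmem S.
  by rewrite eqxx /GRing.scale /= mulr1.
rewrite (annis_mem _ _ iS) ?mem_index_enum //; case: eqP => [S0|_].
  by rewrite S0 inE in iS.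
by rewrite scaler0.
Qed.

(** A preimage of the vacuum under f_1 ... f_n, obtained by normalising the top coefficient of the
    constant function 1. Letting Cl act on it sends f to the vacuum, whereas for n > 0 the vacuum
    itself is killed by f. *)
Definition vac_lift : M :=
  (coef (index_enum 'I_n) [ffun=> 1])^-1 *: ([ffun=> 1] : M).

Lemma annis_vac_lift : annis (index_enum 'I_n) vac_lift = vac.
Proof.
have [|c c0 E] := @annisE (index_enum 'I_n) [ffun=> 1] set0 (index_enum_uniq _).
  by move=> i; rewrite inE.
have cE : coef (index_enum 'I_n) [ffun=> 1] = c by rewrite /coef E ffunE mulr1.
rewrite annis_enum /vac_lift cE.
have -> : coef (index_enum 'I_n) (c^-1 *: ([ffun=> 1] : M)) = 1.
  by rewrite linearZ /= cE /GRing.scale /= mulVf.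
by rewrite scale1r.
Qed.

End Fock.

(** * The quadrics and their vanishing on an orbit *)

Section Wick.
Variables (F : fieldType) (n : nat).
Hypothesis two_neq0 : 2%:R != 0 :> F.
Local Notation M := (fock F n).
Implicit Types (i j k a b c d : 'I_n) (x y : M) (l : seq 'I_n).

Lemma coef_anni l i x : coef l (anni i x) = coef (rcons l i) x.
Proof. by rewrite /coef /annis -cats1 foldr_cat. Qed.

Lemma coef_anni2 l i j x : coef l (anni i (anni j x)) = coef (l ++ [:: i; j]) x.
Proof. by rewrite /coef /annis foldr_cat. Qed.

Lemma coef_add l x y : coef l (x + y) = coef l x + coef l y.
Proof. by have := coef_is_linear l 1 x y; rewrite !scale1r. Qed.

Lemma coef_sub l x y : coef l (x - y) = coef l x - coef l y.
Proof. by rewrite -scaleN1r addrC coef_is_linear scaleN1r addrC. Qed.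

Lemma coef_scale l (t : F) x : coef l (t *: x) = t * coef l x.
Proof.
have := coef_is_linear l t x 0; rewrite !addr0 => ->.
by have := coef_sub l 0 0; rewrite !subrr => ->; rewrite addr0.
Qed.

Lemma coef_nuniq l x : ~~ uniq l -> coef l x = 0.
Proof. by move=> ul; rewrite /coef annis_nuniq // ffunE. Qed.

Lemma coef_rcons_crea l i j x : coef (rcons l i) (crea j x) =
  (if i == j then 2%:R * coef l x else 0) - coef l (crea j (anni i x)).
Proof.
rewrite -coef_anni anni_crea coef_sub coef_scale.
by case: eqP => _; rewrite ?mul0r.
Qed.

Lemma coef_opp l x : coef l (- x) = - coef l x.
Proof. by rewrite -scaleN1r coef_scale mulN1r. Qed.

Lemma coef_swap l1 l2 i j x :
  coef (l1 ++ i :: j :: l2) x = - coef (l1 ++ j :: i :: l2) x.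
Proof.
rewrite /coef /annis !foldr_cat /= anni_anticomm; exact: (coef_opp l1).
Qed.

(** The four-point Wick relation, homogenised by the degree 0 coefficient. *)
Definition wick a b c d x : F :=
  coef [::] x * coef [:: a; b; c; d] x
  - coef [:: a; b] x * coef [:: c; d] x
  + coef [:: a; c] x * coef [:: b; d] x
  - coef [:: a; d] x * coef [:: b; c] x.

Lemma coef2_swap i j x : coef [:: i; j] x = - coef [:: j; i] x.
Proof. exact: (coef_swap [::] [::]). Qed.

Lemma wick_swap12 a b c d x : wick b a c d x = - wick a b c d x.
Proof.
rewrite /wick (coef_swap [::] [:: c; d] b a) (coef2_swap b a) /=.
by ring.
Qed.

Lemma wick_swap23 a b c d x : wick a c b d x = - wick a b c d x.
Proof.
rewrite /wick (coef_swap [:: a] [:: d] c b) (coef2_swap c b) /=.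
by ring.
Qed.

Lemma wick_swap34 a b c d x : wick a b d c x = - wick a b c d x.
Proof.
rewrite /wick (coef_swap [:: a; b] [::] d c) (coef2_swap d c) /=.
by ring.
Qed.

(** In a coefficient of e_a f_i x, the factor e_a survives only by contracting with f_a, which
    leaves f_i in the place of f_a with a factor 2. Each term of the quadric contains the index [a]
    in exactly one factor, so no second-order term appears. *)
Lemma wick_replace a b c d i x : uniq [:: a; b; c; d] -> i \notin [:: a; b; c; d] ->
  wick a b c d (x + crea a (anni i x)) = wick a b c d x + 2%:R * wick i b c d x.
Proof.
rewrite /= !inE !negb_or andbT -!andbA => /and5P[ab ac ad bc /andP[bd cd]].
case/and4P=> ia ib ic id.
have rc l j y : j != a -> coef (rcons l j) (crea a y) = - coef l (crea a (anni j y)).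
  by move=> ja; rewrite coef_rcons_crea (negbTE ja) sub0r.
have ra l y : coef (rcons l a) (crea a y) = 2%:R * coef l y - coef l (crea a (anni a y)).
  by rewrite coef_rcons_crea eqxx.
have c0 y : coef [::] (crea a y) = 0 := coef_crea a y.
rewrite eq_sym in ab; rewrite eq_sym in ac; rewrite eq_sym in ad.
have E2 j k y : j != a -> k != a -> coef [:: j; k] (crea a y) = 0.
  move=> ja ka; rewrite (rc [:: j]) // (rc [::]) // c0; ring.
have E1 k y : k != a -> coef [:: a; k] (crea a y) = - 2%:R * coef [:: k] y.
  move=> ka; rewrite (rc [:: a]) // (ra [::]) c0 -/(coef [::] _) coef_anni /=; ring.
have E4 y : coef [:: a; b; c; d] (crea a y) = - 2%:R * coef [:: b; c; d] y.
  rewrite (rc [:: a; b; c]) // (rc [:: a; b]) // (rc [:: a]) // (ra [::]) c0.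
  by rewrite !coef_anni /=; ring.
rewrite /wick !coef_add E4 !E1 ?E2 // c0 !coef_anni /=.
rewrite (coef2_swap i b) (coef2_swap i c) (coef2_swap i d).
rewrite (coef_swap [::] [:: c; d] i b) (coef_swap [:: b] [:: d] i c).
rewrite (coef_swap [:: b; c] [::] i d) /=.
by ring.
Qed.

Section Orbit.
Variable O : M -> Prop.
Hypothesis Oee : forall i j (t : F) y,
  i != j -> O y -> O (y + t *: crea i (crea j y)).
Hypothesis Off : forall i j (t : F) y,
  i != j -> O y -> O (y + t *: anni i (anni j y)).
Hypothesis Oef : forall i j (t : F) y,
  i != j -> O y -> O (y + t *: crea i (anni j y)).
Hypothesis Oeven : forall y l, O y -> odd (size l) -> coef l y = 0.

(** The four indices form a list, so that permuting and replacing them become list operations; lists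
    of any other length give [False]. *)
Let wick_null l : Prop := if l is [:: a; b; c; d] then
  forall y, O y -> wick a b c d y = 0 else False.

Let wick_null_swap l1 l2 i j :
  wick_null (l1 ++ i :: j :: l2) -> wick_null (l1 ++ j :: i :: l2).
Proof.
case: l1 => [|a [|b [|c [|d [|? l1]]]]]; case: l2 => [|e [|f [|g l2]]] //= w0 y Oy.
- by rewrite wick_swap12 w0 // oppr0.
- by rewrite wick_swap23 w0 // oppr0.
- by rewrite wick_swap34 w0 // oppr0.
Qed.

Let wick_null_move l1 l2 l3 i :
  wick_null (l1 ++ l2 ++ i :: l3) -> wick_null (l1 ++ i :: l2 ++ l3).
Proof.
elim: l2 l1 => //= j l2 IHl2 l1 w0.
have := IHl2 (rcons l1 j); rewrite !cat_rcons => /(_ w0).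
exact: wick_null_swap.
Qed.

Let wick_null_moveV l1 l2 l3 i :
  wick_null (l1 ++ i :: l2 ++ l3) -> wick_null (l1 ++ l2 ++ i :: l3).
Proof.
elim: l2 l1 => //= j l2 IHl2 l1 w0.
have := IHl2 (rcons l1 j); rewrite !cat_rcons; apply.
exact: wick_null_swap.
Qed.

Let wick_null_replace l1 l2 i j : uniq (l1 ++ i :: l2) ->
  j \notin (l1 ++ i :: l2) -> wick_null (l1 ++ i :: l2) ->
  wick_null (l1 ++ j :: l2).
Proof.
have head l : uniq (i :: l) -> j \notin i :: l ->
    wick_null (i :: l) -> wick_null (j :: l).
  case: l => [|b [|c [|d [|e l]]]] // ul jl w0 y Oy.
  have ij : i != j by apply: contraNneq jl => ->; rewrite mem_head.
  (* The quadric vanishes at y and at (1 + e_i f_j) y, and the two values differ by twice the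
     quadric with [j] in place of [i]. *)
  have := w0 _ (Oef 1 ij Oy); rewrite scale1r wick_replace // w0 // add0r.
  by move/eqP; rewrite mulf_eq0 (negbTE two_neq0) => /eqP.
have pe : perm_eq (i :: l1 ++ l2) (l1 ++ i :: l2).
  by rewrite -cat1s perm_catCA.
rewrite -(perm_uniq pe) -(perm_mem pe) => ul jl w0.
by apply: (wick_null_moveV (l1 := [::])); apply: head => //; exact: (wick_null_move (l1 := [::])).
Qed.

Let wick_null_fill l l1 : uniq (l1 ++ l) -> forall l2, size l2 = size l ->
  uniq (l1 ++ l2) -> wick_null (l1 ++ l2) -> wick_null (l1 ++ l).
Proof.
elim: l l1 => [|i l IHl] l1 ul l2; first by move/size0nil ->.
case: l2 => // j l2 [sl2] ul2 w0.
rewrite -cat_rcons; rewrite -cat_rcons in ul.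
have il1 : i \notin l1.
  by apply/negP=> il; move: ul; rewrite cat_uniq rcons_uniq il.
have [il2|il2] := boolP (i \in j :: l2); last first.
  apply: (IHl _ ul l2 sl2); rewrite cat_rcons; last first.
    by apply: wick_null_replace w0 => //; rewrite mem_cat negb_or il1.
  have pu k : uniq (l1 ++ k :: l2) = uniq (k :: l1 ++ l2).
    by apply: perm_uniq; rewrite -cat1s perm_catCA.
  move: ul2 il2; rewrite !pu /= !inE !mem_cat !negb_or il1 /=.
  by move=> /andP[_ ->] /andP[_ ->].
have [l3 [l4 El]] : exists l3 l4, j :: l2 = l3 ++ i :: l4.
  by case/splitPr: il2 => l3 l4; exists l3, l4.
rewrite El in w0 ul2.
apply: (IHl _ ul (l3 ++ l4)).
- have := congr1 size El; rewrite !size_cat /= addnS => -[]; rewrite sl2 => ->.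
  by [].
- rewrite cat_rcons -(perm_uniq _ : uniq (l1 ++ l3 ++ i :: l4) = _) //.
  by rewrite perm_cat2l -cat1s perm_catCA.
by rewrite cat_rcons; exact: wick_null_move.
Qed.

Let coef_shift l i j (t : F) y : coef l (y + t *: anni i (anni j y)) =
  coef l y + t * coef (l ++ [:: i; j]) y.
Proof. by rewrite coef_add coef_scale coef_anni2. Qed.

(** If the lowest nonzero coefficient sits at l ++ [:: i; j], applying 1 + f_i f_j makes the one at
    [l] nonzero and keeps those of degree below that of [l] zero, so the lowest degree drops by
    2. *)
Let coef0_neq0 (k : nat) y l : O y -> size l = k.*2 -> coef l y != 0 ->
  (forall l', (size l' < k.*2)%N -> coef l' y = 0) ->
  exists2 y', O y' & coef [::] y' != 0.
Proof.
elim: k y l => [|k IHk] y l Oy; first by move/size0nil=> -> y0 _; exists y.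
case/lastP: l => // l j; case/lastP: l => // l i.
rewrite -!cats1 -catA /= size_cat doubleS addn2 => -[sl] y0 small.
have ij : i != j.
  apply: contraNneq y0 => eij; rewrite coef_nuniq ?eqxx // cat_uniq /= eij inE eqxx.
  by rewrite !andbF.
apply: (IHk (y + 1 *: anni i (anni j y)) l) => //; first exact: Off.
  by rewrite coef_shift mul1r small ?add0r // sl ltnS leqnSn.
move=> l' sl'; rewrite coef_shift mul1r !small ?addr0 //.
  by rewrite size_cat addn2 !ltnS.
by rewrite (ltn_trans sl') // ltnS leqnSn.
Qed.

Let exists_coef0_neq0 y : O y -> y != 0 -> exists2 y', O y' & coef [::] y' != 0.
Proof.
move=> Oy y0.
have : exists k : nat, `[< exists2 l, size l = k & coef l y != 0 >].
  apply: contrapT => /forallNP nex; case/eqP: y0.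
  apply: (coef_inj two_neq0) => l _; apply: contrapT => /eqP l0.
  by case: (nex (size l)); apply/asboolP; exists l.
case/ex_minnP=> k /asboolP[l sl l0] kmin.
have ek : ~~ odd k.
  by apply: contra_neqN l0 => ok; apply: Oeven => //; rewrite sl.
have kE : k./2.*2 = k by rewrite even_halfK.
apply: (@coef0_neq0 k./2 y l) => //; rewrite kE // => l' sl'.
apply: contrapT => /eqP l'0; move: sl'; rewrite ltnNge kmin //.
by apply/asboolP; exists l'.
Qed.

Let coef2_crea2 p q i j y : coef [:: p; q] (crea i (crea j y)) =
  4%:R * ((q == i)%:R * (p == j)%:R - (p == i)%:R * (q == j)%:R) * coef [::] y.
Proof.
have c0 (z : M) i' : coef [::] (crea i' z) = 0 := coef_crea i' z.
have c1 (z : M) i' k' : coef [:: k'] (crea i' z) = 2%:R * (k' == i')%:R * coef [::] z.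
  by rewrite -[[:: k']]/(rcons [::] k') coef_rcons_crea c0; case: eqP => _ /=; ring.
rewrite -[[:: p; q]]/(rcons [:: p] q) coef_rcons_crea !c1 coef_anni c1.
by case: eqP => _ /=; ring.
Qed.

(** Each factor 1 + t e_i e_j changes only the degree 2 coefficients at (i, j) and (j, i), so the
    number of nonzero ones strictly decreases. *)
Let degree2_null y : O y -> coef [::] y != 0 -> exists y',
  [/\ O y', coef [::] y' != 0 & forall i j, coef [:: i; j] y' = 0].
Proof.
pose supp y := [set p : 'I_n * 'I_n | coef [:: p.1; p.2] y != 0].
have [m] := ubnP #|supp y|; elim: m y => // m IHm y sm Oy y0.
have [s0|[[i j]]] := set_0Vmem (supp y).
  exists y; split=> // i j; apply/eqP; have := in_set0 (i, j).
  by rewrite -s0 inE => /negbFE.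
rewrite inE /= => ij0.
have ij : i != j.
  by apply: contraNneq ij0 => ->; rewrite coef_nuniq //= inE eqxx.
(* By [coef2_crea2], e_i e_j y has coefficient -4 <y> at (i, j), so this [t] cancels the coefficient
   there. *)
pose t := coef [:: i; j] y / (4%:R * coef [::] y).
apply: (IHm (y + t *: crea i (crea j y))); last 2 first.
- exact: Oee.
- by rewrite coef_add coef_scale coef_crea mulr0 addr0.
have four : 4%:R != 0 :> F by rewrite (natrM _ 2 2) mulf_neq0.
rewrite ltnS in sm; apply: leq_trans sm; apply: proper_card; apply/properP; split.
  apply/subsetP=> -[p q]; rewrite !inE /= coef_add coef_scale coef2_crea2.
  apply: contra_neq => pq0; rewrite pq0 add0r.
  have [qi|_] := eqVneq q i; have [pj|_] := eqVneq p j.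
  - by move: ij0; rewrite coef2_swap -qi -pj pq0 oppr0 eqxx.
  - have [pi|_] := eqVneq p i; last by rewrite /=; ring.
    by rewrite qi (negbTE ij) /=; ring.
  - rewrite pj eq_sym (negbTE ij) /=; ring.
  have [pi|_] := eqVneq p i; last by rewrite /=; ring.
  have [qj|_] := eqVneq q j; last by rewrite /=; ring.
  by move: ij0; rewrite -pi -qj pq0 eqxx.
exists (i, j); rewrite !inE //= coef_add coef_scale coef2_crea2 negbK !eqxx.
by rewrite eq_sym (negbTE ij) /=; apply/eqP; rewrite /t; field; rewrite four y0.
Qed.

(** In degree 4 the quadric reduces to <y><f_a f_b f_c f_d y> = 0. In higher degree, 1 + f_i f_j
    copies the coefficient at l ++ [:: i; j] to [l], two degrees lower, without changing <y>. *)
Let coef_null (k : nat) y l : O y -> coef [::] y != 0 ->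
  (forall a b c d y', uniq [:: a; b; c; d] -> O y' -> wick a b c d y' = 0) ->
  uniq l -> size l = k.+2.*2 ->
  (forall l', (0 < size l' < k.+2.*2)%N -> coef l' y = 0) ->
  coef l y = 0.
Proof.
elim: k y l => [|k IHk] y l Oy y0 w0 ul sl small.
  case: l sl ul => [|a [|b [|c [|d [|]]]]] // _ ul.
  have := w0 _ _ _ _ _ ul Oy.
  rewrite /wick (small [:: a; b]) // (small [:: a; c]) // (small [:: a; d]) //.
  by rewrite !mul0r subr0 addr0 subr0 => /eqP; rewrite mulf_eq0 (negbTE y0) => /eqP.
case/lastP: l ul sl => // l j; case/lastP: l => // l i.
rewrite -!cats1 -catA /= size_cat doubleS addn2 => ul [sl].
have ij : i != j.
  by move: ul; rewrite cat_uniq /= inE => /and3P[_ _ /andP[]].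
pose y' := y + 1 *: anni i (anni j y).
have small' l' : (0 < size l')%N -> (size l' < k.+2.*2)%N -> coef l' y = 0.
  move=> l'0 sl'; apply: small; rewrite l'0 /= doubleS.
  by rewrite (ltn_trans sl') // ltnS leqnSn.
have /eqP : coef l y' = 0.
  apply: IHk => //; first exact: Off.
  - by rewrite coef_shift mul1r (small [:: i; j]) // addr0.
  - by move: ul; rewrite cat_uniq => /andP[].
  move=> l' /andP[l'0 sl']; rewrite coef_shift mul1r small' // add0r.
  by apply: small; rewrite size_cat addn2 doubleS !ltnS.
rewrite coef_shift mul1r small ?add0r; first by move/eqP.
by rewrite sl doubleS /= ltnS leqnSn.
Qed.

Lemma wick_orbit_vac a b c d y : uniq [:: a; b; c; d] ->
  (forall z, O z -> wick a b c d z = 0) -> O y -> y != 0 ->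
  exists z, O z /\ exists t : F, z = t *: vac F n.
Proof.
move=> uabcd w0 Oy y0.
have wnull a' b' c' d' y' : uniq [:: a'; b'; c'; d'] -> O y' -> wick a' b' c' d' y' = 0.
  move=> u'; apply: (@wick_null_fill [:: a'; b'; c'; d'] [::] u' [:: a; b; c; d]) => //.
have [y1 Oy1 y10] := exists_coef0_neq0 Oy y0.
have [z [Oz z0 z2]] := degree2_null Oy1 y10.
(* Induction on the degree: odd coefficients vanish by parity, those of degree 2 by the choice of
   [z], and even degrees from 4 on by [coef_null]. *)
have small m l : (0 < size l < m)%N -> coef l z = 0.
  elim: m l => [|m IHm] l; first by rewrite andbF.
  case/andP=> l0; rewrite ltnS leq_eqVlt => /orP[/eqP sl|sl]; last first.
    by apply: IHm; rewrite l0.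
  have [ul|] := boolP (uniq l); last exact: coef_nuniq.
  have [om|em] := boolP (odd m); first by apply: Oeven; rewrite // sl.
  case: (ltnP m 4) => m4.
    case: m {IHm} sl em m4 => [|[|[|[|m]]]] // sl _ _; first by rewrite sl in l0.
    by case: l sl {l0 ul} => [|i [|j [|]]].
  have mE : m = (m./2 - 2).+2.*2.
    have m2 : (2 <= m./2)%N by rewrite -leq_double even_halfK.
    by rewrite -addn2 subnK // even_halfK.
  apply: (@coef_null (m./2 - 2)) => //; rewrite -?mE //.
exists z; split=> //; exists (coef [::] z).
apply/eqP; rewrite -subr_eq0; apply/eqP/(coef_inj two_neq0) => l _.
rewrite coef_sub coef_scale; case/lastP: l => [|l i].
  by rewrite coef_nil_vac mulr1 subrr.
by rewrite coef_vac mulr0 subr0 (small (size l).+2) // size_rcons /=.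
Qed.

End Orbit.
End Wick.

(** * Additivity of the action and the parity grading *)

Section FockParity.
Variables (F : fieldType) (n : nat).
Local Notation M := (fock F n).
Implicit Types (v : 'rV[F]_(n + n)) (x y : M).

Lemma fock_actDl v v' x : fock_act (v + v') x = fock_act v x + fock_act v' x.
Proof. by have := fock_act_linl x 1 v v'; rewrite !scale1r. Qed.

Lemma fock_act0l x : fock_act 0 x = 0.
Proof.
by have := fock_act_linl x (-1) 0 0; rewrite scaler0 addr0 scaleN1r addNr.
Qed.

Lemma fock_actZl c v x : fock_act (c *: v) x = c *: fock_act v x.
Proof. by have := fock_act_linl x c v 0; rewrite fock_act0l !addr0. Qed.

Lemma fock_act0r v : fock_act v 0 = 0.
Proof. exact: (linear0 (fock_act v)). Qed.

Lemma fock_actDr v x y : fock_act v (x + y) = fock_act v x + fock_act v y.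
Proof. exact: (linearD (fock_act v)). Qed.

Lemma fock_actZr c v x : fock_act v (c *: x) = c *: fock_act v x.
Proof. by rewrite linearZ. Qed.

Definition fock_parity (b : bool) x :=
  forall S : {set 'I_n}, odd #|S| != b -> x S = 0.

Lemma fock_parity0 b : fock_parity b 0.
Proof. by move=> S _; rewrite ffunE. Qed.

Lemma fock_parityP b c x y :
  fock_parity b x -> fock_parity b y -> fock_parity b (c *: x + y).
Proof.
move=> bx by_ S bS; rewrite !ffunE bx // by_ // addr0.
by rewrite /GRing.scale /= mulr0.
Qed.

Lemma fock_parity_sum b I (r : seq I) (c : I -> F) (E : I -> M) :
  (forall i, fock_parity b (E i)) -> fock_parity b (\sum_(i <- r) c i *: E i).
Proof.
move=> bE; elim/big_rec: _ => [|i y _]; first exact: fock_parity0.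
exact: fock_parityP.
Qed.

Lemma fock_parity_crea b i x : fock_parity b x -> fock_parity (~~ b) (crea i x).
Proof.
move=> bx S; rewrite ffunE; case: ifP => // iS; rewrite (cardsD1 i) iS /= => bS.
by rewrite bx ?mulr0 //; apply: contra bS => /eqP ->.
Qed.

Lemma fock_parity_anni b i x : fock_parity b x -> fock_parity (~~ b) (anni i x).
Proof.
move=> bx S bS; rewrite ffunE; case: ifP => // iS.
rewrite bx ?mulr0 // cardsU1 iS /=.
by apply: contra bS => /eqP <-; rewrite negbK.
Qed.

Lemma fock_parity_act b v x : fock_parity b x -> fock_parity (~~ b) (fock_act v x).
Proof.
move=> bx; rewrite fock_act.unlock -[X in X + _]scale1r; apply: fock_parityP.
  by apply: fock_parity_sum => i; exact: fock_parity_crea.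
by apply: fock_parity_sum => i; exact: fock_parity_anni.
Qed.

Lemma fock_parity_vac : fock_parity false (vac F n).
Proof. by move=> S; rewrite ffunE; have [->|] := eqVneq S set0; rewrite ?cards0. Qed.

Lemma coef_parity b l x : fock_parity b x -> odd (size l) != b -> coef l x = 0.
Proof.
move=> bx lb; have : fock_parity (odd (size l) (+) b) (annis l x).
  by elim: l {lb} => //= i l IHl; rewrite addNb; exact: fock_parity_anni.
by apply; rewrite cards0; case: odd b lb {bx} => [] [].
Qed.

End FockParity.

(** * The Fock space as a module over the Clifford algebra *)

Section FockModule.
Variables (F : fieldType) (n : nat).
Hypothesis two_neq0 : 2%:R != 0 :> F.
Local Notation M := (fock F n).
Local Notation T := (tensor F (n + n)).
Variable u : M.

Definition word_act (w : {fmonom 'I_(n + n)}) (x : M) : M :=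
  foldr (fun a => fock_act (delta_mx 0 a)) x (w : seq 'I_(n + n)).

Lemma word_act_is_linear w : linear (word_act w).
Proof.
move=> c x y; rewrite /word_act.
by elim: (fmonom_val w) => //= a l ->; rewrite linearP.
Qed.
HB.instance Definition _ w :=
  GRing.isLinear.Build F M M *:%R (word_act w) (word_act_is_linear w).

(** The result of letting the tensor [t] act on the fixed vector [u]. *)
Definition fock_tensor (t : T) : M :=
  [ffun S : {set 'I_n} =>
     mmap idfun (fun w : {fmonom 'I_(n + n)} => word_act w u S : F) t].

Lemma fock_tensor_is_linear : linear fock_tensor.
Proof.
move=> c s t; apply/ffunP=> S; rewrite !ffunE mmapD; congr (_ + _).
rewrite (mmapEw (msuppZ_le c s)) mmapE scaler_sumr; apply: eq_bigr => k _ /=.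
by rewrite linearZ /= /GRing.scale /= mulrA.
Qed.
HB.instance Definition _ :=
  GRing.isLinear.Build F T M *:%R fock_tensor fock_tensor_is_linear.

Lemma fock_tensorU c w : fock_tensor << c *g w >> = c *: word_act w u.
Proof. by apply/ffunP=> S; rewrite !ffunE mmapU. Qed.

Lemma fock_tensorUM c w (t : T) :
  fock_tensor (<< c *g w >> * t) = c *: word_act w (fock_tensor t).
Proof.
rewrite [t in LHS]monalgE [t in RHS]monalgE mulr_sumr !linear_sum /=.
apply: eq_bigr => k _.
rewrite malgM_def fgmulUU !fock_tensorU linearZ scalerA /=; congr (_ *: _).
by rewrite /word_act fmM foldr_cat.
Qed.

Lemma fock_tensorM0 (s t : T) : fock_tensor t = 0 -> fock_tensor (s * t) = 0.
Proof.
move=> t0; rewrite [s]monalgE mulr_suml linear_sum big1 // => k _ /=.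
by rewrite fock_tensorUM t0 linear0 scaler0.
Qed.

Lemma fock_tensor_vecM v (t : T) :
  fock_tensor (tvec v * t) = fock_act v (fock_tensor t).
Proof.
rewrite tvec.unlock mulr_suml linear_sum /=.
rewrite [v in RHS]row_sum_delta.
rewrite (big_morph (fun v => fock_act v (fock_tensor t)) (id1 := 0) (op1 := +%R)).
- apply: eq_bigr => a _; rewrite fock_actZl fock_tensorUM.
  by rewrite /word_act fmU.
- by move=> v1 v2; rewrite fock_actDl.
by rewrite fock_act0l.
Qed.

(** A Clifford relation r acts as zero on every vector, in particular on b u, so each term a r b of
    an ideal element kills [u]. *)
Lemma fock_tensor_ideal (t : T) :
  t \in gen_ideal (cliff_rel (hyp F n)) -> fock_tensor t = 0.
Proof.
move=> /asboolP[l [Pl ->]]; rewrite linear_sum big_seq big1 // => x /Pl[v ->] /=.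
rewrite -mulrA; apply: fock_tensorM0.
rewrite mulrBl linearB /= -mulrA !fock_tensor_vecM fock_act_sqr //.
by rewrite -scalerAl mul1r linearZ subrr.
Qed.

Definition fock_cl (x : Cl F n) : M := fock_tensor (repr x).

Lemma fock_cl_pi t : fock_cl (cl_pi (hyp F n) t) = fock_tensor t.
Proof.
apply/eqP; rewrite -subr_eq0 -linearB /=; apply/eqP/fock_tensor_ideal.
by apply/qpiP; rewrite qpiK.
Qed.

Lemma fock_cl_is_linear : linear fock_cl.
Proof.
move=> a; elim/qpiW=> s; elim/qpiW=> t.
by rewrite -linearP -!/(cl_pi (hyp F n) _) !fock_cl_pi linearP.
Qed.
HB.instance Definition _ :=
  GRing.isLinear.Build F (Cl F n) M *:%R fock_cl fock_cl_is_linear.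

Lemma fock_cl_vecM v (x : Cl F n) :
  fock_cl (cl_vec (hyp F n) v * x : Cl F n) = fock_act v (fock_cl x).
Proof.
elim/qpiW: x => t.
by rewrite /cl_vec /cl_pi -rmorphM -!/(cl_pi (hyp F n) _) !fock_cl_pi fock_tensor_vecM.
Qed.

Lemma fock_cl1 : fock_cl 1 = u.
Proof.
rewrite -(qpi1 (cliff_rel (hyp F n))) -/(cl_pi _ _) fock_cl_pi.
have -> : (1 : T) = mkmalgU (mone : {fmonom 'I_(n + n)}) (1 : F) by [].
by rewrite fock_tensorU scale1r /word_act fm1.
Qed.

End FockModule.

(** * Spinors as combinations of creation words times f *)

Section SpinorSpan.
Variables (F : fieldType) (n : nat).
Hypothesis two_neq0 : 2%:R != 0 :> F.
Local Notation M := (fock F n).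
Local Notation Cl := (Cl F n).
Implicit Types (i j : 'I_n) (x y : Cl) (l : seq 'I_n).

Definition egen i : Cl := cl_vec (hyp F n) (evec F i).
Definition fgen i : Cl := cl_vec (hyp F n) (fvec F i).

Lemma cl_vecD u v : cl_vec (hyp F n) (u + v) = cl_vec (hyp F n) u + cl_vec (hyp F n) v.
Proof. exact: linearD. Qed.

Lemma scaleCl_l c x y : (c *: x) * y = c *: (x * y).
Proof. by rewrite qscalerAl. Qed.

Lemma scaleCl_r c x y : x * (c *: y) = c *: (x * y).
Proof. by rewrite qscalerAr. Qed.

Lemma bil_delta (a b : 'I_(n + n)) :
  bil (hyp F n) (delta_mx 0 a) (delta_mx 0 b) = hyp F n a b.
Proof. by rewrite /bil -rowE trmx_delta -colE !mxE. Qed.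

Lemma bil_ee i j : bil (hyp F n) (evec F i) (evec F j) = 0.
Proof. by rewrite bil_delta /hyp block_mxEul mxE. Qed.

Lemma bil_ff i j : bil (hyp F n) (fvec F i) (fvec F j) = 0.
Proof. by rewrite bil_delta /hyp block_mxEdr mxE. Qed.

Lemma bil_ef i j : bil (hyp F n) (evec F i) (fvec F j) = (i == j)%:R.
Proof. by rewrite bil_delta /hyp block_mxEur mxE. Qed.

Lemma bil_fe i j : bil (hyp F n) (fvec F i) (evec F j) = (i == j)%:R.
Proof. by rewrite bil_delta /hyp block_mxEdl mxE. Qed.

Lemma egen_anticomm i j : egen i * egen j = - (egen j * egen i).
Proof. by apply: cl_vec_anticomm; rewrite !bil_ee addr0. Qed.

Lemma fgen_anticomm i j : fgen i * fgen j = - (fgen j * fgen i).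
Proof. by apply: cl_vec_anticomm; rewrite !bil_ff addr0. Qed.

Lemma egen_sqr i : egen i * egen i = 0.
Proof. by rewrite /egen cl_vec_sqr bil_ee scale0r. Qed.

Lemma fgen_sqr i : fgen i * fgen i = 0.
Proof. by rewrite /fgen cl_vec_sqr bil_ff scale0r. Qed.

Lemma fgen_egen i j :
  fgen i * egen j = (if i == j then 2%:R else 0 : F) *: (1 : Cl) - egen j * fgen i.
Proof.
have [<-|ij] := eqVneq i j; last first.
  rewrite scale0r sub0r; apply: cl_vec_anticomm.
  by rewrite bil_ef bil_fe eq_sym (negbTE ij) addr0.
have := cl_vec_sqr (hyp F n) (evec F i + fvec F i).
rewrite cl_vecD -!/(egen i) -!/(fgen i) mulrDl !mulrDr egen_sqr fgen_sqr add0r addr0.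
have -> : bil (hyp F n) (evec F i + fvec F i) (evec F i + fvec F i) = 2%:R.
  have addE (A B : 'M[F]_1) : (A + B) 0 0 = A 0 0 + B 0 0 by rewrite mxE.
  rewrite /bil linearD /= !mulmxDl !mulmxDr !addE -!/(bil _ _ _).
  by rewrite bil_ee bil_ff bil_ef bil_fe eqxx /= add0r addr0 -mulr2n.
by move=> <-; rewrite addrAC subrr add0r.
Qed.

Lemma fprod_fgen : Defs.fprod F n = \prod_(i <- index_enum 'I_n) fgen i.
Proof. by []. Qed.

Lemma fgen_fprod i : fgen i * Defs.fprod F n = 0.
Proof.
rewrite fprod_fgen.
have : i \in index_enum 'I_n by rewrite mem_index_enum.
elim: (index_enum 'I_n) => // j l IHl; rewrite inE big_cons mulrA.
case/orP=> [/eqP <-|/IHl il0]; first by rewrite fgen_sqr mul0r.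
by rewrite fgen_anticomm mulNr -mulrA il0 mulr0 oppr0.
Qed.

Definition eword l : Cl := \prod_(i <- l) egen i.

(** A normal form for Cl^+ f and Cl^- f, told apart by the parity [b] of the word length; it permits
    induction on words. *)
Definition espan (b : bool) x := exists l : seq (F * seq 'I_n),
  all (fun p => odd (size p.2) == b) l /\
  x = \sum_(p <- l) p.1 *: (eword p.2 * Defs.fprod F n).

Lemma espan0 b : espan b 0.
Proof. by exists [::]; rewrite big_nil. Qed.

Lemma espanP b c x y : espan b x -> espan b y -> espan b (c *: x + y).
Proof.
move=> [l1 [b1 ->]] [l2 [b2 ->]].
exists ([seq (c * p.1, p.2) | p <- l1] ++ l2); split.
  by rewrite all_cat all_map b2 andbT; exact: b1.
rewrite big_cat big_map scaler_sumr; congr (_ + _).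
by apply: eq_bigr => p _; rewrite scalerA.
Qed.

Lemma espanZ b c x : espan b x -> espan b (c *: x).
Proof. by move=> bx; rewrite -[c *: x]addr0; apply: espanP => //; exact: espan0. Qed.

Lemma espanB b x y : espan b x -> espan b y -> espan b (x - y).
Proof. by move=> bx by_; rewrite addrC -scaleN1r; exact: espanP. Qed.

Lemma espan_sum b I (r : seq I) (c : I -> F) (E : I -> Cl) :
  (forall k, espan b (E k)) -> espan b (\sum_(i <- r) c i *: E i).
Proof.
move=> bE; elim/big_rec: _ => [|i y _]; first exact: espan0.
exact: espanP.
Qed.

Lemma espan_eword l : espan (odd (size l)) (eword l * Defs.fprod F n).
Proof.
exists [:: (1, l)]; rewrite big_seq1 scale1r /= eqxx; split=> //.
Qed.

Lemma espan_ind (P : Cl -> Prop) b x : P 0 ->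
  (forall c y z, P y -> P z -> P (c *: y + z)) ->
  (forall l, odd (size l) = b -> P (eword l * Defs.fprod F n)) -> espan b x -> P x.
Proof.
move=> P0 PD Pw [l [lb ->]]; elim: l lb => [|p l IHl] /=; first by rewrite big_nil.
case/andP=> /eqP pb /IHl Pl; rewrite big_cons; apply: PD => //; exact: Pw.
Qed.

Lemma espan_egenM b i x : espan b x -> espan (~~ b) (egen i * x).
Proof.
apply: (@espan_ind (fun x => espan (~~ b) (egen i * x))) => [|c y z iy iz|l <-].
- by rewrite mulr0; exact: espan0.
- by rewrite mulrDr scaleCl_r; exact: espanP.
have -> : egen i * (eword l * Defs.fprod F n) = eword (i :: l) * Defs.fprod F n.
  by rewrite /eword big_cons mulrA.
exact: (espan_eword (i :: l)).
Qed.

(** Anticommuting f_i to the right through the word removes letters in pairs with f_i, until f_i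
    meets f and gives 0. *)
Lemma espan_fgenM b i x : espan b x -> espan (~~ b) (fgen i * x).
Proof.
apply: (@espan_ind (fun x => espan (~~ b) (fgen i * x))) => [|c y z iy iz|l <-].
- by rewrite mulr0; exact: espan0.
- by rewrite mulrDr scaleCl_r; exact: espanP.
elim: l => [|j l IHl].
  by rewrite /eword big_nil mul1r fgen_fprod; exact: espan0.
rewrite /eword big_cons -mulrA mulrA fgen_egen mulrBl scaleCl_l mul1r -mulrA.
rewrite /= negbK; apply: espanB; first by apply: espanZ; exact: espan_eword.
by rewrite -[odd _]negbK; exact: espan_egenM.
Qed.

Lemma espan_vecM b v x : espan b x -> espan (~~ b) (cl_vec (hyp F n) v * x).
Proof.
move=> bx; rewrite [v]row_sum_delta linear_sum mulr_suml.
rewrite (eq_bigr (fun a => v 0 a *: (cl_vec (hyp F n) (delta_mx 0 a) * x))); last first.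
  by move=> a _; rewrite linearZ /= scaleCl_l.
apply: espan_sum => a; rewrite -(splitK a); case: (split a) => i /=.
  exact: espan_egenM.
exact: espan_fgenM.
Qed.

Lemma espan_even (a : Cl) : cl_even a -> espan false (a * Defs.fprod F n).
Proof.
case=> l [el ->]; rewrite mulr_suml.
elim: l el => [|p l IHl] /=; first by rewrite big_nil => _; exact: espan0.
case/andP=> ep /IHl sl; rewrite big_cons scaleCl_l; apply: espanP => //.
rewrite -(negbTE ep); elim: p.2 => [|v r IHr] /=.
  by rewrite big_nil; have := espan_eword [::]; rewrite /eword big_nil.
by rewrite big_cons -mulrA; exact: espan_vecM.
Qed.

End SpinorSpan.

(** * The embedding of spinors into the Fock space *)

Section ToFock.
Variables (F : fieldType) (n : nat).
Hypothesis two_neq0 : 2%:R != 0 :> F.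
Local Notation M := (fock F n).
Local Notation Cl := (Cl F n).
Implicit Types (i j : 'I_n) (x y : Cl) (l : seq 'I_n).

Definition to_fock x : M := fock_cl (vac_lift F n) x.

Lemma to_fock_is_linear : linear to_fock.
Proof. exact: (fock_cl_is_linear two_neq0). Qed.
HB.instance Definition _ :=
  GRing.isLinear.Build F Cl M *:%R to_fock to_fock_is_linear.

Lemma to_fockM v x :
  to_fock (cl_vec (hyp F n) v * x : Cl) = fock_act v (to_fock x).
Proof. exact: fock_cl_vecM. Qed.

Lemma to_fock_fprod : to_fock (Defs.fprod F n) = vac F n.
Proof.
rewrite fprod_fgen -(annis_vac_lift _ two_neq0).
elim: (index_enum 'I_n) => [|i l IHl]; first by rewrite big_nil; exact: fock_cl1.
by rewrite big_cons to_fockM IHl fock_act_fvec.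
Qed.

Lemma to_fock_parity b x : espan b x -> fock_parity b (to_fock x).
Proof.
apply: (@espan_ind _ _ (fun x => fock_parity b (to_fock x))) => [|c y z|l <-].
- by rewrite linear0; exact: fock_parity0.
- by rewrite linearP; exact: fock_parityP.
elim: l => [|i l IHl] /=.
  by rewrite /eword big_nil mul1r to_fock_fprod; exact: fock_parity_vac.
by rewrite /eword big_cons -mulrA to_fockM; exact: fock_parity_act.
Qed.

(** Left multiplication by f_i e_i / 2 fixes whatever f_i kills and annihilates e_i; the product
    over all i projects onto the line of f. *)
Let proj i : Cl := 2%:R^-1 *: (fgen F i * egen F i).

Let proj_egen_eq i : proj i * egen F i = 0.
Proof. by rewrite /proj scaleCl_l -mulrA egen_sqr mulr0 scaler0. Qed.

Let proj_egen_neq i j : i != j -> proj i * egen F j = egen F j * proj i.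
Proof.
move=> ij; rewrite /proj scaleCl_l scaleCl_r; congr (_ *: _).
rewrite -mulrA egen_anticomm mulrN !mulrA fgen_egen (negbTE ij) scale0r sub0r.
by rewrite mulNr opprK.
Qed.

Let projs_egen l j : (\prod_(i <- l) proj i) * egen F j =
  if j \in l then 0 else egen F j * \prod_(i <- l) proj i.
Proof.
elim: l => [|i l IHl]; first by rewrite big_nil mul1r mulr1.
rewrite big_cons -mulrA IHl inE; have [->|ij] := eqVneq j i => /=.
  by case: ifP => _; rewrite ?mulr0 // mulrA proj_egen_eq mul0r.
case: ifP => _; first by rewrite mulr0.
by rewrite mulrA proj_egen_neq 1?eq_sym // mulrA.
Qed.

Let proj_id i x : fgen F i * x = 0 -> proj i * x = x.
Proof.
move=> ix; rewrite /proj scaleCl_l fgen_egen eqxx mulrBl -mulrA ix mulr0 subr0.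
by rewrite scaleCl_l mul1r scalerA mulVf // scale1r.
Qed.

(** The product of all [proj i] fixes [x], while it kills every nonempty creation word times f; only
    the multiple of f in [x] remains. *)
Lemma vacuum_unique b x : espan b x -> (forall i, fgen F i * x = 0) ->
  exists c : F, x = c *: Defs.fprod F n.
Proof.
move=> bx fx; have <- : (\prod_(i <- index_enum 'I_n) proj i) * x = x.
  elim: (index_enum 'I_n) => [|i l IHl]; first by rewrite big_nil mul1r.
  by rewrite big_cons -mulrA IHl proj_id.
apply: (@espan_ind _ _ (fun x => exists c : F,
   (\prod_(i <- index_enum 'I_n) proj i) * x = c *: Defs.fprod F n) b) bx.
- by exists 0; rewrite mulr0 scale0r.
- move=> c y z [cy Ey] [cz Ez]; exists (c * cy + cz).
  by rewrite mulrDr scaleCl_r Ey Ez scalerA scalerDl.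
case=> [|i l] _.
  exists 1; rewrite /eword big_nil mul1r scale1r.
  elim: (index_enum 'I_n) => [|i l IHl]; first by rewrite big_nil mul1r.
  by rewrite big_cons -mulrA IHl proj_id // fgen_fprod.
exists 0; rewrite /eword big_cons -mulrA mulrA projs_egen mem_index_enum.
by rewrite mul0r scale0r.
Qed.

Lemma vac_neq0 : vac F n != 0.
Proof.
apply/eqP=> /ffunP/(_ set0); rewrite !ffunE eqxx => /eqP.
by rewrite oner_eq0.
Qed.

Lemma fgens_nuniq l x : ~~ uniq l -> \prod_(i <- l) fgen F i * x = 0.
Proof.
elim: l => //= i l IHl; rewrite big_cons negb_and negbK -mulrA.
case/orP=> [|/IHl->]; last by rewrite mulr0.
elim: l {IHl} => // j l IHl; rewrite inE big_cons -[_ * _ * x]mulrA mulrA.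
case/orP=> [/eqP <-|/IHl il]; first by rewrite fgen_sqr mul0r.
by rewrite fgen_anticomm mulNr -mulrA il mulr0 oppr0.
Qed.

(* A longest nonvanishing product of f_i applied to x is a nonzero multiple   *)
(* of f, whose image is a nonzero multiple of the vacuum.                     *)
Lemma to_fock_inj b x : espan b x -> to_fock x = 0 -> x = 0.
Proof.
move=> bx x0; apply: contrapT => /eqP xn0.
pose P k := `[< exists2 l, size l = k & \prod_(i <- l) fgen F i * x != 0 >].
have exP : exists k, P k.
  exists 0%N; apply/asboolP; exists [::]; first exact: erefl.
  by rewrite big_nil mul1r.
have ubP k : P k -> (k <= n)%N.
  case/asboolP=> l <- lx; have ul : uniq l.
    by apply: contraNT lx => ul; rewrite fgens_nuniq.
  by rewrite -(card_uniqP ul) -[leqRHS]card_ord max_card.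
case: (ex_maxnP exP ubP) => k /asboolP[l sl y0] kmax.
set y := _ * x in y0.
have fy i : fgen F i * y = 0.
  apply: contrapT => /eqP iy; suff: (k.+1 <= k)%N by rewrite ltnn.
  apply: kmax; apply/asboolP; exists (i :: l); first by rewrite /= sl.
  by rewrite big_cons -mulrA.
have [b' by_] : exists b', espan b' y.
  rewrite /y; elim: l {sl y0 y fy} => [|i l [b' IHl]].
    by exists b; rewrite big_nil mul1r.
  by exists (~~ b'); rewrite big_cons -mulrA; exact: espan_fgenM.
have [c yE] := vacuum_unique by_ fy.
have : to_fock y = 0.
  rewrite /y; elim: l {sl y0 y fy by_ yE} => [|i l IHl]; first by rewrite big_nil mul1r.
  by rewrite big_cons -mulrA to_fockM IHl linear0.
rewrite yE linearZ /= to_fock_fprod => /eqP.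
rewrite scaler_eq0 (negbTE vac_neq0) orbF => /eqP c0.
by move: y0; rewrite yE c0 scale0r eqxx.
Qed.

End ToFock.

(** * Pure spinors and their invariance under the spin group *)

Section Purity.
Variables (F : fieldType) (n : nat).
Hypothesis two_neq0 : 2%:R != 0 :> F.
Local Notation M := (fock F n).
Local Notation Cl := (Cl F n).
Local Notation V := 'rV[F]_(n + n).
Local Notation bilV := (bil (hyp F n)).
Implicit Types (u v z : V) (x y : M).

(** For nonzero [x] the isotropy of [H] is recovered in [isotropic_fixed]; the vertex of the cone is
    listed apart. *)
Definition fock_pure x : Prop := x = 0 \/
  exists H : {vspace V}, \dim H = n /\ {in H, forall v, fock_act v x = 0}.

Lemma bil_hypC u v : bilV u v = bilV v u.
Proof.
by rewrite !bil_hyp; apply: eq_bigr => i _; rewrite addrC ![_ * v _ _]mulrC.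
Qed.

Lemma fock_act_anticomm u v x :
  fock_act u (fock_act v x) = (2%:R * bilV u v) *: x - fock_act v (fock_act u x).
Proof.
have := fock_act_sqr two_neq0 (u + v) x.
rewrite !fock_actDl !fock_actDr !fock_act_sqr //.
have -> : bilV (u + v) (u + v) = bilV u u + 2%:R * bilV u v + bilV v v.
  rewrite !bil_hyp mulr_sumr -!big_split; apply: eq_bigr => i _; rewrite /= !mxE; ring.
rewrite 2!scalerDl => E; apply: (addrI (bilV u u *: x)).
apply: (addIr (fock_act v (fock_act u x) + bilV v v *: x)).
by rewrite E -[RHS]addrA subrKA addrA.
Qed.

Lemma bil_hypDr u v z : bilV u (v + z) = bilV u v + bilV u z.
Proof.
by rewrite !bil_hyp -big_split; apply: eq_bigr => i _; rewrite /= !mxE; ring.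
Qed.

Lemma bil_hypZr c u v : bilV u (c *: v) = c * bilV u v.
Proof.
by rewrite !bil_hyp mulr_sumr; apply: eq_bigr => i _; rewrite /= !mxE; ring.
Qed.

(** If u and v both kill x, then 0 = (uv + vu) x = 2 (u|v) x. *)
Lemma isotropic_fixed (H : {vspace V}) x : x != 0 ->
  {in H, forall v, fock_act v x = 0} -> isotropic H.
Proof.
move=> x0 Hx u v uH vH.
have := fock_act_anticomm u v x.
rewrite Hx // linear0 Hx // linear0 subr0 => /esym/eqP.
by rewrite scaler_eq0 (negbTE x0) orbF mulf_eq0 (negbTE two_neq0) => /eqP.
Qed.

Definition fincl (u : 'rV[F]_n) : V := row_mx 0 u.

Fact fincl_is_linear : linear fincl.
Proof. by move=> a u v; rewrite /fincl scale_row_mx add_row_mx scaler0 addr0. Qed.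
HB.instance Definition _ := GRing.isLinear.Build F 'rV[F]_n V *:%R
  fincl fincl_is_linear.

Definition fspace : {vspace V} := limg (linfun fincl).

Lemma dim_fspace : \dim fspace = n.
Proof.
rewrite limg_dim_eq ?dimvf /dim /= ?mul1n //.
apply/eqP; rewrite -subv0; apply/subvP=> u; rewrite memv_cap memvf /= memv_ker lfunE /=.
rewrite -row_mx0 /fincl => /eqP/eq_row_mx[_ ->]; exact: mem0v.
Qed.

Lemma fspaceP v : v \in fspace -> exists u : 'rV[F]_n, v = fincl u.
Proof. by case/memv_imgP=> u _ ->; exists u; rewrite lfunE. Qed.

Lemma isotropic_fspace : isotropic fspace.
Proof.
move=> _ _ /fspaceP[u ->] /fspaceP[v ->]; rewrite /fincl bil_hyp big1 // => i _.
by rewrite !row_mxEl !mxE mul0r mulr0 addr0.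
Qed.

Lemma pure_vac (t : F) : fock_pure (t *: vac F n).
Proof.
right; exists fspace; split; first exact: dim_fspace.
move=> _ /fspaceP[u ->]; rewrite /fincl fock_actZr fock_act.unlock !big1 ?addr0 ?scaler0 // => i _.
  by rewrite anni_vac scaler0.
by rewrite row_mxEl mxE scale0r.
Qed.

(* The isometry exp(s u /\ v) of V, for orthogonal isotropic u and v.         *)
Definition so_exp (s : F) u v z : V :=
  z + ((2%:R * s * bilV v z) *: u + (- (2%:R * s * bilV u z)) *: v).

Lemma so_exp_is_linear s u v : linear (so_exp s u v).
Proof.
move=> a y z; rewrite /so_exp !bil_hypDr !bil_hypZr; apply/rowP=> k.
by rewrite !mxE; ring.
Qed.
HB.instance Definition _ s u v :=
  GRing.isLinear.Build F V V *:%R (so_exp s u v) (so_exp_is_linear s u v).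

(* Left multiplication by exp(s u v) = 1 + s u v intertwines the action of z  *)
(* with that of its image under exp(s u /\ v).                                *)
Lemma pure_exp (s : F) u v x : bilV u u = 0 -> bilV v v = 0 -> bilV u v = 0 ->
  fock_pure x -> fock_pure (x + s *: fock_act u (fock_act v x)).
Proof.
move=> uu vv uv [->|[H [dimH Hx]]].
  by left; rewrite !fock_act0r scaler0 addr0.
have vu : bilV v u = 0 by rewrite bil_hypC.
right; exists (linfun (so_exp s u v) @: H)%VS; split.
  (* Injectivity of the isometry: if [z] maps to 0, pairing the image with [v] and [u] gives (v|z) =
     (u|z) = 0, so the image is [z] itself. *)
  rewrite limg_dim_eq //; apply/eqP; rewrite -subv0; apply/subvP=> z.
  rewrite memv_cap memv_ker lfunE /= => /andP[_ /eqP z0].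
  have : bilV v (so_exp s u v z) = 0 by rewrite z0 -(scale0r 0) bil_hypZr mul0r.
  rewrite /so_exp !bil_hypDr !bil_hypZr vu vv !mulr0 !addr0 => vz.
  have : bilV u (so_exp s u v z) = 0 by rewrite z0 -(scale0r 0) bil_hypZr mul0r.
  rewrite /so_exp !bil_hypDr !bil_hypZr uu uv !mulr0 !addr0 => uz.
  by move: z0; rewrite /so_exp vz uz !mulr0 oppr0 !scale0r !addr0 => ->; exact: mem0v.
move=> _ /memv_imgP[z zH ->]; rewrite lfunE /=.
have uuy y : fock_act u (fock_act u y) = 0 by rewrite fock_act_sqr // uu scale0r.
have vvy y : fock_act v (fock_act v y) = 0 by rewrite fock_act_sqr // vv scale0r.
have vuv : fock_act v (fock_act u (fock_act v x)) = 0.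
  by rewrite fock_act_anticomm vu mulr0 scale0r sub0r vvy fock_act0r oppr0.
have zuv : fock_act z (fock_act u (fock_act v x)) =
    (2%:R * bilV u z) *: fock_act v x - (2%:R * bilV v z) *: fock_act u x.
  rewrite fock_act_anticomm (fock_act_anticomm z v) (Hx z) // fock_act0r subr0.
  by rewrite fock_actZr (bil_hypC u) (bil_hypC v).
rewrite /so_exp !fock_actDl !fock_actZl !fock_actDr !fock_actZr uuy vuv zuv.
rewrite (Hx z) // !scaler0 !addr0 add0r scalerBr !scalerA scaleNr.
rewrite (_ : s * _ = 2%:R * s * bilV u z); last by ring.
rewrite (_ : s * _ = 2%:R * s * bilV v z); last by ring.
by rewrite addrA subrK subrr.
Qed.

(** Orthogonal vectors anticommute, so (uv - vu)/4 = uv/2. *)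
Lemma wedge_act u v (x : Cl) : bilV u v = 0 ->
  to_fock (wedge u v * x : Cl) = 2%:R^-1 *: fock_act u (fock_act v (to_fock x)).
Proof.
move=> uv; rewrite /wedge scaleCl_l mulrBl -!mulrA linearZ linearB /= !to_fockM //.
rewrite (fock_act_anticomm v) bil_hypC uv mulr0 scale0r sub0r opprK.
rewrite -mulr2n -scaler_nat scalerA; congr (_ *: _).
by rewrite (natrM F 2 2) invfM -mulrA mulVf ?mulr1.
Qed.

Lemma root_vectorP (X : Cl) : root_vector X -> exists u v,
  [/\ bilV u u = 0, bilV v v = 0, bilV u v = 0 & X = wedge u v].
Proof.
case=> i [j [ij]] [] ->; [exists (evec F i), (evec F j) |
  exists (fvec F i), (fvec F j) | exists (evec F i), (fvec F j)]; split=> //;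
  by rewrite ?bil_ee ?bil_ff ?bil_ef // (negbTE ij).
Qed.

Definition spinor_fock (s : spinor F n) : M := to_fock (spinor_val s).

Lemma is_exp_sqr0 (W : lmodType F) (T E : W -> W) : T 0 = 0 ->
  (forall w, T (T w) = 0) -> is_exp T E -> forall w, E w = w + T w.
Proof.
move=> T0 TT [N [nilN EE]] w; rewrite EE.
have T2 k : iter k.+2 T w = 0 by elim: k => [|k IHk]; rewrite ?iterS ?IHk //= TT.
(* The nilpotency bound [N] may be below 2; then the truncated series is shorter, but the missing
   terms are zero. *)
case: N nilN {EE} => [|[|N]] nilN.
- by have /= -> := nilN w; rewrite T0 addr0 big_ord0.
- have /= Tw := nilN w.
  by rewrite big_ord1 /= Tw addr0 invr1 scale1r.
rewrite !big_ord_recl big1 => [|k _]; last by rewrite T2 scaler0.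
by rewrite /= !invr1 !scale1r addr0.
Qed.

Lemma sqr0_is_exp (W : lmodType F) (T : W -> W) :
  (forall w, T (T w) = 0) -> is_exp T (fun w => w + T w).
Proof.
move=> TT; exists 2; split=> [w|w]; first by rewrite /= TT.
by rewrite !big_ord_recl big_ord0 /= !invr1 !scale1r addr0.
Qed.

Lemma spinor_act_sqr0 (t : F) (X : Cl) : root_vector X ->
  forall s, spinor_act (t *: X) (spinor_act (t *: X) s) = 0.
Proof.
move=> /root_vector_sqr[XX _] s; apply: val_inj => /=.
by rewrite !scaleCl_l scaleCl_r !mulrA XX mul0r !scaler0.
Qed.

Lemma spinor_act0 (a : Cl) : spinor_act a 0 = 0.
Proof. by apply: val_inj; rewrite /= mulr0. Qed.

(** Stated as an equivalence so that the induction over the group passes through inverses. *)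
Lemma Spin_pure g s : Spin g ->
  fock_pure (spinor_fock s) <-> fock_pure (spinor_fock (g s)).
Proof.
move=> Sg; elim: Sg s => {g} [t X g rX gE||g h _ IHg _ IHh|g h _ IHg gh hg] s //.
- have [u [v [uu vv uv XE]]] := root_vectorP rX.
  have gs r : spinor_fock (g r) =
      spinor_fock r + (t / 2%:R) *: fock_act u (fock_act v (spinor_fock r)).
    rewrite (is_exp_sqr0 (spinor_act0 _) (spinor_act_sqr0 t rX) gE).
    rewrite /spinor_fock /= linearD /= scaleCl_l linearZ /= XE wedge_act //.
    by rewrite scalerA.
  rewrite gs; split=> [|pg]; first exact: pure_exp.
  (* 1 - s uv is inverse to 1 + s uv, since (uv)(uv) = 0. *)
  have := pure_exp (- (t / 2%:R)) uu vv uv pg.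
  have uuy y : fock_act u (fock_act u y) = 0 by rewrite fock_act_sqr // uu scale0r.
  have vvy y : fock_act v (fock_act v y) = 0 by rewrite fock_act_sqr // vv scale0r.
  rewrite !fock_actDr !fock_actZr (fock_act_anticomm v u) bil_hypC uv mulr0 scale0r.
  rewrite sub0r vvy fock_act0r oppr0 fock_act0r scaler0 addr0 scaleNr addrK //.
- by rewrite IHh IHg.
by rewrite -{1}[s]hg -IHg.
Qed.

Lemma halfspin_espan (w : halfspin F n) : espan false (halfspin_val w).
Proof. by case: w => x /= /asboolP[a ea ->]; exact: espan_even. Qed.

Lemma Gr_iso_plusE (w : halfspin F n) :
  Gr_iso_plus w <-> fock_pure (to_fock (halfspin_val w)).
Proof.
have act0 v : spinor_act (cl_vec (hyp F n) v) (halfspin_spinor w) = 0 <->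
    fock_act v (to_fock (halfspin_val w)) = 0.
  split=> [/(congr1 val) /= vw|vw]; first by rewrite -to_fockM // vw linear0.
  apply: val_inj => /=; apply: (to_fock_inj two_neq0); last by rewrite to_fockM.
  by apply: espan_vecM; exact: halfspin_espan.
split=> [[H [dimH _ Hw]]|].
  by right; exists H; split=> // v /Hw/act0.
have [w0 _|w0] := eqVneq (to_fock (halfspin_val w)) 0.
  (* The zero spinor lies in every [S_H]; F_n serves as [H]. *)
  exists fspace; split; [exact: dim_fspace | exact: isotropic_fspace |].
  by move=> v _; apply/act0; rewrite w0 fock_act0r.
case=> [w0E|[H [dimH Hw]]]; first by rewrite w0E eqxx in w0.
exists H; split=> //; first exact: isotropic_fixed Hw.
by move=> v /Hw/act0.
Qed.

End Purity.

(** * Projection to fewer indices preserves purity *)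

Section Restriction.
Variables (F : fieldType) (n m : nat) (le_mn : (m <= n)%N).
Hypothesis two_neq0 : 2%:R != 0 :> F.
Local Notation wd := (widen_ord le_mn).
Implicit Types (x : fock F n) (v : 'rV[F]_(n + n)).

(** The projection sending e_j to 0 for j >= m, read on coordinates: only monomials in the first m
    letters are kept. *)
Definition restr x : fock F m := [ffun S : {set 'I_m} => x (wd @: S)].

Lemma restr_is_linear : linear restr.
Proof. by move=> a x y; apply/ffunP=> S; rewrite !ffunE. Qed.
HB.instance Definition _ :=
  GRing.isLinear.Build F (fock F n) (fock F m) *:%R restr restr_is_linear.

Let wd_inj : injective wd.
Proof. by move=> i j /(congr1 val) /= /val_inj. Qed.

Lemma fsign_widen (i : 'I_m) (S : {set 'I_m}) :
  fsign F (wd i) (wd @: S) = fsign F i S.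
Proof.
rewrite /fsign -[in RHS](card_imset _ wd_inj); congr (_ ^+ _).
apply: eq_card => j; rewrite inE; apply/andP/imsetP => [[/imsetP[k kS ->] ki]|[k]].
  by exists k; rewrite // inE kS.
by rewrite inE => /andP[kS ki] ->; rewrite imset_f.
Qed.

Lemma restr_crea i x : restr (crea (wd i) x) = crea i (restr x).
Proof.
apply/ffunP=> S; rewrite !ffunE (mem_imset _ _ wd_inj); case: ifP => // iS.
rewrite fsign_widen; congr (_ * x _); apply/setP=> j; rewrite !inE.
apply/andP/imsetP => [[ji /imsetP[k kS jk]]|[k]].
  by exists k; rewrite // !inE kS andbT; apply: contra_neq ji => <-.
by rewrite !inE => /andP[ki kS] ->; rewrite imset_f // (inj_eq wd_inj).
Qed.

Lemma restr_anni i x : restr (anni (wd i) x) = anni i (restr x).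
Proof.
apply/ffunP=> S; rewrite !ffunE (mem_imset _ _ wd_inj); case: ifP => // iS.
by rewrite fsign_widen imsetU1.
Qed.

Lemma restr_crea_ge (j : 'I_n) x : (m <= j)%N -> restr (crea j x) = 0.
Proof.
move=> mj; apply/ffunP=> S; rewrite !ffunE; case: ifP => // /imsetP[k _ jk].
by move: mj; rewrite jk /= leqNgt ltn_ord.
Qed.

Lemma restr_vac : restr (vac F n) = vac F m.
Proof. by apply/ffunP=> S; rewrite !ffunE imset_eq0. Qed.

Lemma coef_restr (l : seq 'I_m) x : coef l (restr x) = coef (map wd l) x.
Proof.
have E : annis l (restr x) = restr (annis (map wd l) x).
  by elim: l => //= i l ->; rewrite restr_anni.
by rewrite /coef E ffunE imset0.
Qed.

Lemma wick_restr i j k l x :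
  wick i j k l (restr x) = wick (wd i) (wd j) (wd k) (wd l) x.
Proof. by rewrite /wick !coef_restr. Qed.

Definition vrestr v : 'rV[F]_(m + m) :=
  row_mx (\row_i v 0 (lshift n (wd i))) (\row_i v 0 (rshift n (wd i))).

Lemma vrestr_is_linear : linear vrestr.
Proof.
move=> a u v; rewrite /vrestr scale_row_mx add_row_mx.
by congr row_mx; apply/rowP=> i; rewrite !mxE.
Qed.
HB.instance Definition _ :=
  GRing.isLinear.Build F 'rV[F]_(n + n) 'rV[F]_(m + m) *:%R vrestr
    vrestr_is_linear.

(** Restriction kills the image of e_j for j >= m but not that of f_j, hence the condition on the
    f-coordinates of [v]. *)
Lemma restr_act v x : (forall j : 'I_n, (m <= j)%N -> v 0 (rshift n j) = 0) ->
  restr (fock_act v x) = fock_act (vrestr v) (restr x).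
Proof.
move=> v0; rewrite !fock_act.unlock linearD !linear_sum /=; congr (_ + _).
  rewrite (bigID (fun i : 'I_n => (i < m)%N)) /= [X in _ + X]big1 ?addr0.
    rewrite (big_ord_narrow le_mn); apply: eq_bigr => i _.
    by rewrite linearZ /= restr_crea row_mxEl mxE.
  by move=> i; rewrite -leqNgt => mi; rewrite linearZ /= restr_crea_ge ?scaler0.
rewrite (bigID (fun i : 'I_n => (i < m)%N)) /= [X in _ + X]big1 ?addr0.
  rewrite (big_ord_narrow le_mn); apply: eq_bigr => i _.
  by rewrite linearZ /= restr_anni row_mxEr mxE.
by move=> i; rewrite -leqNgt => mi; rewrite linearZ /= v0 ?scale0r.
Qed.

Lemma exists_subspace (vT : vectType F) (U : {vspace vT}) : (m <= \dim U)%N ->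
  exists2 W : {vspace vT}, (W <= U)%VS & \dim W = m.
Proof.
move=> mU; exists <<take m (vbasis U)>>%VS.
  rewrite -[U in (_ <= U)%VS](span_basis (vbasisP U)); apply: sub_span.
  by move=> v; exact: mem_take.
have: free (take m (vbasis U)).
  by apply: (@catl_free _ _ (drop m (vbasis U))); rewrite cat_take_drop (basis_free (vbasisP U)).
by move/eqnP=> ->; rewrite size_take size_tuple; case: ltngtP mU.
Qed.

Fact tail_subproof (j : 'I_(n - m)) : (m + j < n)%N.
Proof. by rewrite -ltn_subRL. Qed.

(** The f-coordinates of index at least m; they vanish exactly on the orthogonal complement of the
    span of the e_j with j >= m. *)
Definition ftail v : 'rV[F]_(n - m) :=
  \row_j v 0 (rshift n (Ordinal (tail_subproof j))).

Lemma ftail_is_linear : linear ftail.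
Proof. by move=> a u v; apply/rowP=> i; rewrite !mxE. Qed.
HB.instance Definition _ :=
  GRing.isLinear.Build F 'rV[F]_(n + n) 'rV[F]_(n - m) *:%R ftail
    ftail_is_linear.

Lemma ftail0P v (j : 'I_n) : ftail v = 0 -> (m <= j)%N -> v 0 (rshift n j) = 0.
Proof.
move=> v0 mj; have jm : (j - m < n - m)%N by rewrite ltn_sub2r // (leq_ltn_trans mj).
have /rowP/(_ (Ordinal jm)) := v0; rewrite !mxE => <-; congr (v 0 (rshift n _)).
by apply: val_inj; rewrite /= subnKC.
Qed.

(* If v kills x and has zero image in V_m, then applying f_j to v x = 0 gives *)
(* (f_j | v) restr x = 0.                                                     *)
Lemma restr_pure x : fock_pure x -> fock_pure (restr x).
Proof.
case=> [->|[H [dimH Hx]]]; first by left; rewrite linear0.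
have [rx0|rx] := eqVneq (restr x) 0; [by left | right].
pose H1 := (H :&: lker (linfun ftail))%VS.
have H1E v : v \in H1 -> v \in H /\ ftail v = 0.
  by rewrite memv_cap memv_ker lfunE => /andP[-> /eqP].
(* The kernel of [ftail] is cut out by n - m linear conditions. *)
have dimH1 : (m <= \dim H1)%N.
  have := limg_ker_dim (linfun ftail) H; rewrite dimH => dn.
  have dt : (\dim (linfun ftail @: H) <= n - m)%N.
    by apply: leq_trans (dimvS (subvf _)) _; rewrite dimvf /dim /= mul1n.
  by rewrite -(leq_add2r (n - m)) subnKC // -{1}dn leq_add2l.
have inj : (H1 :&: lker (linfun vrestr) = 0)%VS.
  apply/eqP; rewrite -subv0; apply/subvP=> v; rewrite memv_cap memv_ker lfunE /=.
  case/andP=> /H1E[vH vt] /eqP vr0.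
  have vr j : v 0 (rshift n j) = 0.
    have [mj|jm] := leqP m j; first exact: ftail0P.
    have /rowP/(_ (rshift m (Ordinal jm))) := vr0; rewrite row_mxEr !mxE => <-.
    by congr (v 0 (rshift n _)); exact: val_inj.
  have vl j : v 0 (lshift n j) = 0.
    have := fock_act_anticomm two_neq0 (fvec F j) v x.
    rewrite Hx // fock_act0r => /esym/(congr1 restr).
    rewrite linearB linear0 /= restr_act // vr0 fock_act0l subr0 linearZ /=.
    move/eqP; rewrite scaler_eq0 (negbTE rx) orbF mulf_eq0 (negbTE two_neq0) /=.
    rewrite bil_hyp (bigD1 j) //= big1 => [|i ij].
      by rewrite !mxE eq_lrshift andbF mul0r add0r !eqxx mul1r addr0 => /eqP.
    by rewrite !mxE eq_lrshift eq_rshift andbF (negbTE ij) andbF !mul0r addr0.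
  rewrite memv0; apply/eqP/rowP=> a; rewrite mxE -(splitK a).
  by case: (split a) => j /=.
have [W WH dimW] : exists2 W : {vspace _}, (W <= linfun vrestr @: H1)%VS & \dim W = m.
  by apply: exists_subspace; rewrite limg_dim_eq.
exists W; split=> // _ /(subvP WH)/memv_imgP[v /H1E[vH vt] ->].
by rewrite lfunE /= -restr_act ?Hx ?linear0 // => j; exact: ftail0P.
Qed.

Let iso_incl p (v : 'rV[F]_p) :
  bil (hyp F p) (v *m row_mx 1%:M 0) (v *m row_mx 1%:M 0) = bil 0 v v.
Proof.
rewrite /bil mulmx0 mul0mx mul_mx_row mulmx1 mulmx0 /hyp mul_row_block.
by rewrite !mulmx0 !mul0mx mulmx1 !addr0 tr_row_mx mul_row_col trmx0 mulmx0
  mul0mx addr0.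
Qed.

Let iso0 (v : 'rV[F]_n) :
  bil (0 : 'M[F]_m) (v *m (pid_mx m : 'M_(n, m))) (v *m (pid_mx m : 'M_(n, m)))
    = bil (0 : 'M[F]_n) v v.
Proof. by rewrite /bil !mulmx0 !mul0mx. Qed.

Definition ext_incl p (omega : Ext F p) : Cl F p :=
  cl_map (hyp F p) (row_mx 1%:M 0) omega.
Definition ext_proj (omega : Ext F n) : Ext F m :=
  cl_map (0 : 'M[F]_m) (pid_mx m : 'M[F]_(n, m)) omega.

Lemma ext_incl_is_linear p : linear (@ext_incl p).
Proof. exact: (cl_map_is_linear (@iso_incl p)). Qed.
HB.instance Definition _ p :=
  GRing.isLinear.Build F (Ext F p) (Cl F p) *:%R (@ext_incl p)
    (@ext_incl_is_linear p).

Lemma ext_proj_is_linear : linear ext_proj.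
Proof. exact: (cl_map_is_linear iso0). Qed.
HB.instance Definition _ :=
  GRing.isLinear.Build F (Ext F n) (Ext F m) *:%R ext_proj ext_proj_is_linear.

Lemma ext_inclVM p (v : 'rV[F]_p) (omega : Ext F p) :
  ext_incl (cl_vec 0 v * omega : Ext F p) =
  cl_vec (hyp F p) (row_mx v 0) * ext_incl omega.
Proof.
rewrite /ext_incl (cl_mapM (@iso_incl p)) (cl_map_vec (@iso_incl p)).
by rewrite mul_mx_row mulmx1 mulmx0.
Qed.

Lemma ext_projVM (v : 'rV[F]_n) (omega : Ext F n) :
  ext_proj (cl_vec 0 v * omega : Ext F n) =
  cl_vec 0 (v *m pid_mx m) * ext_proj omega.
Proof.
rewrite /ext_proj (cl_mapM iso0).
by rewrite (cl_map_vec iso0).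
Qed.

(** By induction on words in E_n: a letter acts through creations alone, so [restr_act] applies to
    it, and the vacuum restricts to the vacuum. *)
Lemma to_fock_ext_proj (omega : Ext F n) : cl_even omega ->
  to_fock (ext_incl (ext_proj omega) * Defs.fprod F m) =
  restr (to_fock (ext_incl omega * Defs.fprod F n)).
Proof.
case=> l [_ ->]; rewrite !linear_sum !mulr_suml !linear_sum; apply: eq_bigr => p _ /=.
rewrite !linearZ /= !scaleCl_l !linearZ /=; congr (_ *: _).
elim: p.2 => [|v r IHr].
  rewrite big_nil /ext_incl /ext_proj (cl_map1 iso0).
  by rewrite !(cl_map1 (@iso_incl _)) !mul1r !to_fock_fprod ?restr_vac.
rewrite big_cons ext_projVM !ext_inclVM -!mulrA !to_fockM // IHr restr_act.
  congr (fock_act _ _); rewrite /vrestr; congr row_mx; apply/rowP=> i.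
    rewrite [RHS]mxE row_mxEl mxE (bigD1 (wd i)) //= big1 ?addr0 => [|j ji].
      by rewrite mxE eqxx /= ltn_ord mulr1.
    by rewrite mxE [_ == _](negbTE ji) mulr0.
  by rewrite [RHS]mxE row_mxEr !mxE.
by move=> j _; rewrite row_mxEr mxE.
Qed.

Lemma ext_spinor_onto (w : halfspin F n) :
  exists omega : Ext F n, cl_even omega /\ ext_spinor omega = w.
Proof.
have [l [el wE]] := halfspin_espan w.
pose omega : Ext F n :=
  \sum_(p <- l) p.1 *: \prod_(i <- p.2) (cl_vec 0 (delta_mx 0 i) : Ext F n).
have eomega : cl_even omega.
  exists [seq (p.1, [seq delta_mx 0 i | i <- p.2]) | p <- l]; split.
    by rewrite all_map; apply: sub_all el => p /=; rewrite size_map => /eqP ->.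
  by rewrite big_map; apply: eq_bigr => p _; rewrite /= big_map.
exists omega; split=> //; apply: val_inj; rewrite /= ext_spinorE //.
rewrite -/(ext_incl omega) wE linear_sum mulr_suml; apply: eq_bigr => p _.
rewrite linearZ /= scaleCl_l; congr (_ *: _); congr (_ * _).
rewrite /eword; elim: p.2 => [|i r IHr].
  by rewrite !big_nil /ext_incl (cl_map1 (@iso_incl _)).
rewrite !big_cons ext_inclVM IHr; congr (cl_vec _ _ * _).
apply/rowP=> a; rewrite -(splitK a); case: (split a) => j /=.
  by rewrite row_mxEl !mxE eq_lshift.
by rewrite row_mxEr !mxE eq_rlshift andbF.
Qed.

Lemma to_fock_spin_proj (w : halfspin F n) :
  to_fock (halfspin_val (spin_proj m w)) = restr (to_fock (halfspin_val w)).
Proof.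
rewrite /spin_proj /spinor_ext; case: pselect => [h|/(_ (ext_spinor_onto w))//].
case: (cid h) => omega /= [eo <-].
rewrite (ext_spinorE eo) ext_spinorE; first exact: to_fock_ext_proj.
exact: (cl_map_even iso0).
Qed.

End Restriction.

(** * Pure spinors of V_4 satisfy the quadric *)

Section Wick4.
Variables (F : fieldType).
Hypothesis two_neq0 : 2%:R != 0 :> F.
Implicit Types (x : fock F 4) (v : 'rV[F]_(4 + 4)).

Lemma coef_fock_act n (l : seq 'I_n) (v : 'rV[F]_(n + n)) (x : fock F n) :
  coef l (fock_act v x) = \sum_i (v 0 (lshift n i) * coef l (crea i x)
                                 + v 0 (rshift n i) * coef (rcons l i) x).
Proof.
rewrite fock_act.unlock coef_add big_split /=.
have cs (G : 'I_n -> F) (E : 'I_n -> fock F n) :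
    coef l (\sum_i G i *: E i) = \sum_i G i * coef l (E i).
  have := linear_sum (coef l : {linear fock F n -> F^o}).
  move=> ->; apply: eq_bigr => i _; exact: coef_scale.
by rewrite !cs; congr (_ + _); apply: eq_bigr => i _; rewrite coef_anni.
Qed.

Lemma coef1_crea n (i l : 'I_n) (x : fock F n) :
  coef [:: i] (crea l x) = 2%:R * (i == l)%:R * coef [::] x.
Proof.
by rewrite (coef_rcons_crea [::] i) coef_crea; case: eqP => _ /=; ring.
Qed.

Lemma coef3_crea n (i j k l : 'I_n) (x : fock F n) :
  coef [:: i; j; k] (crea l x) = 2%:R * ((k == l)%:R * coef [:: i; j] x
    - (j == l)%:R * coef [:: i; k] x + (i == l)%:R * coef [:: j; k] x).
Proof.
rewrite (coef_rcons_crea [:: i; j] k) (coef_rcons_crea [:: i] j) coef1_crea.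
rewrite !coef_anni /=.
by case: (k == l); case: (j == l); case: (i == l) => /=; ring.
Qed.

(** Here p, q, r, s and p', q', r', s' are the e- and f-coordinates of v, c and d the coefficients
    of degree 0 and 4, and pq, ..., rs those of degree 2. The hypotheses are the degree 1 and degree
    3 parts of v x = 0; the conclusions are explicit linear combinations of them. *)
Lemma wick_kill_ring (p q r s p' q' r' s' c d pq pr ps qr qs rs : F) :
  2%:R * p * c + q' * pq + r' * pr + s' * ps = 0 ->
  2%:R * q * c - p' * pq + r' * qr + s' * qs = 0 ->
  2%:R * r * c - p' * pr - q' * qr + s' * rs = 0 ->
  2%:R * s * c - p' * ps - q' * qs - r' * rs = 0 ->
  2%:R * (r * pq - q * pr + p * qr) + s' * d = 0 ->
  2%:R * (s * pq - q * ps + p * qs) - r' * d = 0 ->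
  2%:R * (s * pr - r * ps + p * rs) + q' * d = 0 ->
  2%:R * (s * qr - r * qs + q * rs) - p' * d = 0 ->
  p * (c * d - pq * rs + pr * qs - ps * qr) = 0 /\
  p' * (c * d - pq * rs + pr * qs - ps * qr) = 0.
Proof.
move=> Ep Eq Er Es Epqr Epqs Eprs Eqrs; split.
  apply: (mulfI two_neq0); rewrite mulr0; transitivity (
    d * (2%:R * p * c + q' * pq + r' * pr + s' * ps)
    - pq * (2%:R * (s * pr - r * ps + p * rs) + q' * d)
    + pr * (2%:R * (s * pq - q * ps + p * qs) - r' * d)
    - ps * (2%:R * (r * pq - q * pr + p * qr) + s' * d)); first by ring.
  by rewrite Ep Eprs Epqs Epqr; ring.
transitivity (
    - c * (2%:R * (s * qr - r * qs + q * rs) - p' * d)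
    + qr * (2%:R * s * c - p' * ps - q' * qs - r' * rs)
    - qs * (2%:R * r * c - p' * pr - q' * qr + s' * rs)
    + rs * (2%:R * q * c - p' * pq + r' * qr + s' * qs)); first by ring.
by rewrite Eq Er Es Eqrs; ring.
Qed.

Lemma wick_kill x v (i j k l : 'I_4) : uniq [:: i; j; k; l] ->
  fock_act v x = 0 ->
  v 0 (lshift 4 i) * wick i j k l x = 0 /\ v 0 (rshift 4 i) * wick i j k l x = 0.
Proof.
move=> u vx.
have sum4 (E : 'I_4 -> F) : \sum_i E i = E i + E j + E k + E l.
  have all4 : [:: i; j; k; l] =i 'I_4.
    by apply/subset_cardP; [rewrite (card_uniqP u) card_ord | apply/subsetP].
  rewrite (eq_bigl (mem [:: i; j; k; l])) => [|a]; last first.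
    by rewrite -[RHS]/(a \in [:: i; j; k; l]) all4.
  by rewrite -(big_uniq _ u) !big_cons big_nil /= addr0 !addrA.
have cvx l' : coef l' (fock_act v x) = 0 by rewrite vx -(scale0r 0) coef_scale mul0r.
have c2 (a : 'I_4) : coef [:: a; a] x = 0.
  by rewrite coef_nuniq //= inE eqxx.
have c4 (a b c : 'I_4) : (coef [:: a; b; c; a] x = 0) *
    ((coef [:: a; b; c; b] x = 0) * (coef [:: a; b; c; c] x = 0)).
  by split; [|split]; rewrite coef_nuniq //= !inE eqxx ?orbT ?andbF.
have [jkli iklj ijlk] : [/\ coef [:: j; k; l; i] x = - coef [:: i; j; k; l] x,
    coef [:: i; k; l; j] x = coef [:: i; j; k; l] x
    & coef [:: i; j; l; k] x = - coef [:: i; j; k; l] x].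
  split; rewrite ?(coef_swap [:: j; k] [::] l i) ?(coef_swap [:: j] [:: l] k i)
      ?(coef_swap [::] [:: k; l] j i) ?(coef_swap [:: i; k] [::] l j)
      ?(coef_swap [:: i] [:: l] k j) ?(coef_swap [:: i; j] [::] l k) /=;
    by rewrite ?opprK.
have := u; rewrite /= !inE !negb_or !andbT -!andbA => /and5P[ij ik il jk /andP[jl kl]].
have nE (a b : 'I_4) : a != b -> ((a == b) = false) * ((b == a) = false).
  by move=> ab; rewrite [b == a]eq_sym (negbTE ab).
have E := (nE _ _ ij, nE _ _ ik, nE _ _ il, nE _ _ jk, nE _ _ jl, nE _ _ kl, eqxx).
have A a := etrans (esym (coef_fock_act [:: a] v x)) (cvx [:: a]).
have T a b c := etrans (esym (coef_fock_act [:: a; b; c] v x)) (cvx [:: a; b; c]).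
have := T j k l; have := T i k l; have := T i j l; have := T i j k.
have := A l; have := A k; have := A j; have := A i.
rewrite !sum4 !coef1_crea !coef3_crea /= !c2 !c4.
rewrite !E /= (coef2_swap j i) (coef2_swap k i) (coef2_swap l i) (coef2_swap k j).
rewrite (coef2_swap l j) (coef2_swap l k) jkli iklj ijlk.
move=> Ai Aj Ak Al Tijk Tijl Tikl Tjkl.
apply: (wick_kill_ring (q := v 0 (lshift 4 j)) (r := v 0 (lshift 4 k))
  (s := v 0 (lshift 4 l)) (q' := v 0 (rshift 4 j)) (r' := v 0 (rshift 4 k))
  (s' := v 0 (rshift 4 l))).
- by rewrite -[RHS]Ai; ring.
- by rewrite -[RHS]Aj; ring.
- by rewrite -[RHS]Ak; ring.
- by rewrite -[RHS]Al; ring.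
- by rewrite -[RHS]Tijk; ring.
- by rewrite -[RHS]Tijl; ring.
- by rewrite -[RHS]Tikl; ring.
by rewrite -[RHS]Tjkl; ring.
Qed.

Let o k : 'I_4 := inord k.

(** One nonzero vector v killing x is enough: by [wick_kill] and the antisymmetry of the quadric,
    each of the eight coordinates of v times the quadric is 0. *)
Lemma pure_wick x : fock_pure x ->
  wick (inord 0) (inord 1) (inord 2) (inord 3) x = 0.
Proof.
case=> [->|[H [dimH Hx]]].
  have c0 l : coef l (0 : fock F 4) = 0 by rewrite -(scale0r 0) coef_scale mul0r.
  by rewrite /wick !c0; ring.
set W := wick _ _ _ _ x.
have [v vH v0] : exists2 v, v \in H & v != 0.
  exists (vpick H); first exact: memv_pick.
  by rewrite vpick0 -dimv_eq0 dimH.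
have oE k : (k < 4)%N -> o k = k :> nat by move=> k4; rewrite /o inordK.
have uo a b c d : all (ltn^~ 4) [:: a; b; c; d] -> uniq [:: a; b; c; d] ->
    uniq [:: o a; o b; o c; o d].
  move=> a4 u; rewrite -(map_inj_uniq val_inj) /=.
  by case/and5P: a4 => a4 b4 c4 d4 _; rewrite /= !oE.
have K a b c d := fun u4 u => wick_kill (@uo a b c d u4 u) (Hx v vH).
have W1 : wick (o 1) (o 0) (o 2) (o 3) x = - W by rewrite wick_swap12.
have W2 : wick (o 2) (o 0) (o 1) (o 3) x = W.
  by rewrite wick_swap12 wick_swap23 opprK.
have W3 : wick (o 3) (o 0) (o 1) (o 2) x = - W.
  by rewrite wick_swap12 wick_swap23 wick_swap34 opprK.
have := K 3 0 1 2 isT isT; have := K 2 0 1 3 isT isT; have := K 1 0 2 3 isT isT.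
have := K 0 1 2 3 isT isT; rewrite W1 W2 W3 -/W.
rewrite !mulrN => -[e0 f0] [e1 f1] [e2 f2] [e3 f3].
apply: contraNeq v0 => W0; apply/eqP/rowP=> a; rewrite mxE.
have z (t : F) : t * W = 0 -> t = 0.
  by move/eqP; rewrite mulf_eq0 (negbTE W0) orbF => /eqP.
have zN (t : F) : - (t * W) = 0 -> t = 0 by move/eqP; rewrite oppr_eq0 => /eqP/z.
have oO k (k4 : (k < 4)%N) : Ordinal k4 = o k.
  by apply: val_inj; rewrite /= oE.
rewrite -(splitK a); case: (split a) => -[[|[|[|[|//]]]] k4] /=.
all: rewrite oO.
all: first [exact: z e0 | exact: zN e1 | exact: z e2 | exact: zN e3
           | exact: z f0 | exact: zN f1 | exact: z f2 | exact: zN f3].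
Qed.

End Wick4.

(** * Spin orbits on which the quadric vanishes *)

Section SpinOrbit.
Variables (F : fieldType) (n : nat).
Hypothesis two_neq0 : 2%:R != 0 :> F.
Implicit Types (w : halfspin F n).

Lemma Spin_inverse (g : spinor F n -> spinor F n) : Spin g ->
  exists h, [/\ Spin h, cancel g h & cancel h g].
Proof.
move=> Sg; have [c [d [_ _ cd dc gE]]] := Spin_act Sg.
have gd : cancel g (spinor_act d).
  by move=> s; apply: val_inj; rewrite /= gE mulrA dc mul1r.
have dg : cancel (spinor_act d) g.
  by move=> s; apply: val_inj; rewrite /= gE mulrA cd mul1r.
by exists (spinor_act d); split=> //; exact: Spin_inv gd dg.
Qed.

Lemma halfspin_actE g w : Spin g ->
  halfspin_val (halfspin_act g w) = spinor_val (g (halfspin_spinor w)).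
Proof. by move=> Sg; rewrite [LHS]insubdK // Spin_halfspin. Qed.

Lemma halfspin_act_pure g w : Spin g -> Gr_iso_plus w ->
  Gr_iso_plus (halfspin_act g w).
Proof.
move=> Sg /(Gr_iso_plusE two_neq0) pw; apply/(Gr_iso_plusE two_neq0).
rewrite halfspin_actE //.
by apply/(Spin_pure two_neq0 (halfspin_spinor w) Sg).
Qed.

Lemma Spin_fock_exp (t : F) u v s :
  bil (hyp F n) u v = 0 -> root_vector (wedge u v) ->
  exists2 g, Spin g & spinor_fock (g s) =
    spinor_fock s + t *: fock_act u (fock_act v (spinor_fock s)).
Proof.
(* The factor 2 offsets the 1/2 in [wedge_act]. *)
move=> uv rX; pose T := spinor_act ((2%:R * t) *: wedge u v).
exists (fun s => s + T s).
  by apply: (Spin_exp rX (t := 2%:R * t)); apply: sqr0_is_exp; exact: spinor_act_sqr0.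
rewrite /spinor_fock /= linearD /= scaleCl_l linearZ /= wedge_act // scalerA.
by rewrite mulrAC mulfV // mul1r.
Qed.

(** The image of the spin orbit of [w] in the Fock space is closed under the three kinds of root
    exponentials, so [wick_orbit_vac] finds a multiple of the vacuum in it; its purity is
    transported back to [w]. *)
Lemma wick_Spin_pure (a b c d : 'I_n) w : uniq [:: a; b; c; d] ->
  (forall g, Spin g -> wick a b c d (spinor_fock (g (halfspin_spinor w))) = 0) ->
  Gr_iso_plus w.
Proof.
move=> uabcd w0; apply/(Gr_iso_plusE two_neq0).
have [->|wn0] := eqVneq (to_fock (halfspin_val w)) 0; first by left.
pose O y := exists2 g, Spin g & y = spinor_fock (g (halfspin_spinor w)).
have Oexp u v (t : F) y : bil (hyp F n) u v = 0 -> root_vector (wedge u v) ->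
    O y -> O (y + t *: fock_act u (fock_act v y)).
  move=> uv rX [g Sg ->].
  have [h Sh hE] := Spin_fock_exp t (g (halfspin_spinor w)) uv rX.
  by exists (h \o g); [exact: Spin_comp | rewrite -hE].
have [] := @wick_orbit_vac F n two_neq0 O _ _ _ _ a b c d (to_fock (halfspin_val w)).
- move=> i j t y ij; rewrite -!fock_act_evec; apply: Oexp; first exact: bil_ee.
  by exists i, j; split=> //; apply: Or31.
- move=> i j t y ij; rewrite -!fock_act_fvec; apply: Oexp; first exact: bil_ff.
  by exists i, j; split=> //; apply: Or32.
- move=> i j t y ij; rewrite -fock_act_evec -fock_act_fvec; apply: Oexp.
    by rewrite bil_ef (negbTE ij).
  by exists i, j; split=> //; apply: Or33.
- move=> y l [g Sg ->] ol; apply: (@coef_parity _ _ false); last by rewrite ol.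
  rewrite /spinor_fock -halfspin_actE //; apply: to_fock_parity => //.
  exact: halfspin_espan.
- by [].
- by move=> _ [g Sg ->]; exact: w0.
- by exists id; first exact: Spin_id.
- by [].
move=> z [[g Sg ->] [t zE]].
apply/(Spin_pure two_neq0 (halfspin_spinor w) Sg); rewrite zE.
exact: pure_vac.
Qed.

End SpinOrbit.

(** * The quadric as a polynomial function *)

Section PolyFun.
Variables (F : fieldType) (W : lmodType F).

Definition to_linear (f : W -> F^o) (lin_f : linear f) : {linear W -> F^o} :=
  HB.pack f (GRing.isLinear.Build F W F^o *:%R f lin_f).

Lemma polyfun1 : polyfun (fun _ : W => 1).
Proof.
exists 0%N, (fun _ => \0%R : {linear W -> F^o}), 1 => w.
by rewrite meval1.
Qed.

Lemma polyfun_wick n (f : W -> fock F n) (a b c d : 'I_n) : linear f ->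
  polyfun (fun w => wick a b c d (f w)).
Proof.
move=> lin_f.
have lin l : linear (fun w => coef l (f w) : F^o).
  by move=> t x y; rewrite lin_f coef_add coef_scale.
(* The eight coefficients in the order in which they occur in [wick], matching the variables X_0,
   ..., X_7. *)
pose ls := [:: [::]; [:: a; b; c; d]; [:: a; b]; [:: c; d]; [:: a; c]; [:: b; d];
  [:: a; d]; [:: b; c]].
pose X k : mpoly 8 F := 'X_(inord k : 'I_8).
exists 8%N, (fun i => to_linear (lin (nth [::] ls i))).
exists (X 0%N * X 1%N - X 2%N * X 3%N + X 4%N * X 5%N - X 6%N * X 7%N) => w.
by rewrite !(mevalD, mevalN, mevalM, mevalXU) /= !inordK.
Qed.

End PolyFun.

(** * The two inclusions *)

Theorem theorem6p1 (K : closedFieldType) (charK0 : [pchar K] =i pred0)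
    (n : nat) (n_ge4 : (4 <= n)%N) (w : halfspin K n) :
  Gr_iso_plus w <->
  zero_locus
    (radical (ideal_span
       (Spin_orbits (vanishing_ideal (@Gr_iso_plus K 4))))) w.
Proof.
have two_neq0 : 2%:R != 0 :> K.
  by have := charK0 2; rewrite !inE => /negbT.
split=> [pw phi [_ [k [N [a [g [ag phiE]]]]]]|w0].
  have : phi w ^+ k = 0.
    rewrite phiE big1 // => i _; have [_ [p [h [hinv [Ip Sh hK hinvK ->]]]]] := ag i.
    have [_ p0] := Ip; rewrite p0 ?mulr0 //.
    apply/(Gr_iso_plusE two_neq0); rewrite (to_fock_spin_proj n_ge4 two_neq0).
    apply: (restr_pure n_ge4 two_neq0); apply/(Gr_iso_plusE two_neq0).
    by apply: halfspin_act_pure => //; exact: Spin_inv hK hinvK.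
  (* The exponent 0 is excluded here as well, since the zeroth power would be 1. *)
  by move/eqP; rewrite expf_eq0 => /andP[_ /eqP].
pose o k : 'I_4 := inord k.
pose p (u : halfspin K 4) := wick (o 0) (o 1) (o 2) (o 3) (to_fock (halfspin_val u)).
have Ip : vanishing_ideal (@Gr_iso_plus K 4) p.
  split; last by move=> u /(Gr_iso_plusE two_neq0); exact: pure_wick.
  apply: (@polyfun_wick _ _ _ (fun u => to_fock (halfspin_val u))) => t x y.
  by rewrite -linearP.
pose wd := widen_ord n_ge4.
apply: (@wick_Spin_pure _ _ two_neq0 (wd (o 0)) (wd (o 1)) (wd (o 2)) (wd (o 3))).
  by rewrite /= !inE -!val_eqE /= !inordK.
(* The translate of the quadric by h = g^-1 evaluates it at g w, so letting g vary covers the whole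
   orbit. *)
move=> g Sg; have [h [Sh gK hK]] := Spin_inverse Sg.
have pE u : p (spin_proj 4 (halfspin_act g u)) =
    wick (wd (o 0)) (wd (o 1)) (wd (o 2)) (wd (o 3)) (spinor_fock (g (halfspin_spinor u))).
  by rewrite /p (to_fock_spin_proj n_ge4 two_neq0) wick_restr halfspin_actE.
rewrite -pE; apply: (w0 (fun u => p (spin_proj 4 (halfspin_act g u)))); split.
  have [c [_ [_ _ _ _ gE]]] := Spin_act Sg.
  have -> : (fun u => p (spin_proj 4 (halfspin_act g u))) = (fun u =>
      wick (wd (o 0)) (wd (o 1)) (wd (o 2)) (wd (o 3)) (to_fock (c * halfspin_val u))).
    by apply/funext => u; rewrite pE /spinor_fock gE.
  apply: (@polyfun_wick _ _ _ (fun u => to_fock (c * halfspin_val u))) => t x y.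
  by rewrite -linearP /= mulrDr scaleCl_r.
(* A generator lies in the radical with exponent 1, as a one-term combination with coefficient 1. *)
exists 1%N, 1%N, (fun _ _ => 1), (fun _ u => p (spin_proj 4 (halfspin_act g u))).
split=> [_|u]; last by rewrite big_ord1 mul1r expr1.
split; first exact: polyfun1.
by exists p, h, g; split.
Qed.
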